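(* Let $A$ be a sufficiently generic $d\times n$ tropical matrix with corresponding tropical hyperplane arrangement $\mathcal{H}(A)$, and set $B=B_A\subseteq K_{d,n}$. Let $\mathcal{S}$ be the set of fine types associated to the vertices of the bounded complex $\mathcal{B}(A)$. Then the volume of the generalized permutohedron $P_B$ is $$\mathrm{Vol}\,P_B=\sum_{T\in\mathcal{S}}\frac{1}{(\mathrm{RD}(T)_1-1)!}\cdots\frac{1}{(\mathrm{RD}(T)_n-1)!}.$$
   Context: A $d\times n$ tropical matrix is a matrix $A=(a_{ik})$ with entries in $\mathbb{R}\cup\{\infty\}$ such that every column has at least one finite entry. $B_A\subseteq K_{d,n}$ is the bipartite graph on $[d]\sqcup[n]$ with an edge $(i,k)$ iff $a_{ik}$ is finite. Let $\mathbb{1}\in\mathbb{R}^d$ be the all-ones vector. $\mathcal{H}(A)$ is the arrangement of max-tropical hyperplanes with apices the columns $\mathbf{a}_k$ of $A$; the $i$-th closed sector of the $k$-th one is $S_i(\mathbf{a}_k)=\{\mathbf{p}\in\mathbb{R}^d/\mathbb{R}\mathbb{1}: p_i-a_{ik}\ge p_j-a_{jk}\ \forall j\in[d]\}$ (with $p_j-\infty=-\infty$). The fine type of $\mathbf{p}$ is $T(\mathbf{p})\in\{0,1\}^{d\times n}$ with $T(\mathbf{p})_{ik}=1$ iff $a_{ik}$ is finite and $\mathbf{p}\in S_i(\mathbf{a}_k)$. For each fine type $T$ that occurs, $C_T=\{\mathbf{q}:T(\mathbf{q})\ge T\}$ is a closed cell; these cells form the tropical complex, a polyhedral subdivision of $\mathbb{R}^d/\mathbb{R}\mathbb{1}$,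 and $\mathcal{B}(A)$ is its subcomplex of bounded cells (vertices are the $0$-dimensional cells). A fine type $T$ is identified with the bipartite graph on $[d]\sqcup[n]$ with edges $(i,k)$ for $T_{ik}=1$; its right degree vector $\mathrm{RD}(T)\in\mathbb{N}^n$ is the vector of degrees of the right nodes $1,\dots,n$, i.e. $\mathrm{RD}(T)_k=\sum_iT_{ik}$. $A$ is sufficiently generic if the regular subdivision of the root polytope $Q_{B_A}=\mathrm{conv}\{\mathbf{e}_i-\mathbf{e}_{\bar j}:(i,j)\in E(B_A)\}\subset\mathbb{R}^{d+n}$ obtained by lifting $\mathbf{e}_i-\mathbf{e}_{\bar j}$ to height $a_{ij}$ and projecting the lower faces is a triangulation. The generalized permutohedron is the Minkowski sum $P_B=\sum_{j=1}^n\Delta_{N_j(B)}\subset\mathbb{R}^d$, where $N_j(B)\subseteq[d]$ is the set of neighbours of $j\in[n]$ and $\Delta_I=\mathrm{conv}\{\mathbf{e}_i:i\in I\}$. $\mathrm{Vol}$ is the $(d-1)$-dimensional volume on the hyperplane $\{\sum_i x_i=n\}$, normalized so that the standard simplex $\Delta_{[d]}$ has volume $1/(d-1)!$. *)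

(* Defs.v *)
From HB Require Import structures.
From mathcomp Require Import all_boot all_order all_algebra.
From mathcomp Require Import all_classical all_reals all_analysis.
Set Implicit Arguments.
Unset Strict Implicit.
Unset Printing Implicit Defensive.
Import Order.TTheory GRing.Theory Num.Theory.
Import numFieldNormedType.Exports.
Local Open Scope classical_set_scope.
Local Open Scope ring_scope.

Section Polytopes.
Variable R : realType.

Definition conv (m : nat) (X : set 'rV[R]_m) : set 'rV[R]_m :=
  smallest (@convex_set R 'rV[R]_m) X.

Definition affinely_independent (m k : nat) (v : 'I_k -> 'rV[R]_m) : Prop :=
  forall w : 'I_k -> R,
    \sum_i w i = 0 -> \sum_i w i *: v i = 0 -> forall i, w i = 0.

(* The empty set is a simplex (k = 0). *)
Definition is_simplex (m : nat) (C : set 'rV[R]_m) : Prop :=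
  exists k (v : 'I_k -> 'rV[R]_m),
    affinely_independent v /\ C = conv (range v).

Definition dotprod (m : nat) (c x : 'rV[R]_m) : R := (c *m x^T) 0 0.

Definition face (m : nat) (c : 'rV[R]_m) (L : set 'rV[R]_m) : set 'rV[R]_m :=
  [set x | L x /\ forall y, L y -> dotprod c x <= dotprod c y].

(* The heights are in the last coordinate of R^(m + 1); a face is lower when it
   is minimized by a functional whose last coordinate is positive. *)
Definition lower_faces (m : nat) (L : set 'rV[R]_(m + 1)) :
    set (set 'rV[R]_(m + 1)) :=
  [set F | exists2 c : 'rV[R]_(m + 1), 0 < c 0 (rshift m ord0) & F = face c L].

(* All cells (of every dimension) of the regular subdivision of
   conv {v i : i in E} induced by the heights w. *)
Definition regular_subdivision (m : nat) (I : Type) (E : set I)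
    (v : I -> 'rV[R]_m) (w : I -> R) : set (set 'rV[R]_m) :=
  [set lsubmx @` F | F in
     lower_faces (conv [set row_mx (v i) (w i)%:M | i in E])].

Definition is_triangulation (m : nat) (S : set (set 'rV[R]_m)) : Prop :=
  forall C, S C -> is_simplex C.

End Polytopes.

Section Volume.
Variable R : realType.

(* Lebesgue measure on R^m, as an iterated product of the Lebesgue measure
   on R. *)
Fixpoint lebesgue_tuple (m : nat) : set (m.-tuple R) -> \bar R :=
  match m with
  | 0 => \d_([tuple])
  | m'.+1 => fun X : set (m'.+1.-tuple R) =>
      (@lebesgue_measure R \x @lebesgue_tuple m')%E
        [set z : R * m'.-tuple R | X [tuple of z.1 :: z.2]]
  end.

(* (d-1)-dimensional volume of a subset of a hyperplane {x | sum_i x_i = c}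
   of R^d: forgetting the last coordinate identifies this hyperplane with
   R^(d-1) and sends the standard simplex to {y >= 0 | sum_i y_i <= 1}, whose
   Lebesgue measure is 1/(d-1)!, so that this is the required normalization. *)
Definition hyperplane_volume (d : nat) (X : set 'rV[R]_d) : \bar R :=
  lebesgue_tuple
    ((fun x : 'rV[R]_d =>
        [tuple x 0 (widen_ord (leq_pred d) i) | i < d.-1]) @` X).

End Volume.

(* Bipartite graphs on [d] + [n], i.e. subgraphs of K_{d,n}, are given by their
   biadjacency matrices. *)
Definition bigraph (d n : nat) := 'M[bool]_(d, n).

Section BipartiteGraphs.
Variables (R : realType) (d n : nat).
Implicit Types B : bigraph d n.

Definition edges B : set ('I_d * 'I_n) := [set e | B e.1 e.2].

Definition right_nbrs B (j : 'I_n) : set 'I_d := [set i | B i j].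

Definition right_degree B (j : 'I_n) : nat := \sum_(i < d) B i j.

Definition simplex_on (I : set 'I_d) : set 'rV[R]_d :=
  conv [set delta_mx 0 i | i in I].

Definition gen_permutohedron B : set 'rV[R]_d :=
  [set x | exists2 y : 'I_n -> 'rV[R]_d,
     (forall j, simplex_on (right_nbrs B j) (y j)) & x = \sum_j y j].

(* e_i - e_{\bar j} *)
Definition root_point (e : 'I_d * 'I_n) : 'rV[R]_(d + n) :=
  delta_mx 0 (lshift n e.1) - delta_mx 0 (rshift d e.2).

End BipartiteGraphs.

(* Tropical matrices have entries in \bar R; +oo is the tropical zero and -oo
   is excluded. *)
Definition tropical_matrix (R : realType) (d n : nat) (A : 'M[\bar R]_(d, n)) :
    Prop :=
  (forall i k, A i k != -oo%E) /\ (forall k, exists i, A i k \is a fin_num).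

Section TropicalArrangement.
Variables (R : realType) (d n : nat) (A : 'M[\bar R]_(d, n)).

Definition support_graph : bigraph d n := \matrix_(i, k) (A i k \is a fin_num).

Definition sufficiently_generic : Prop :=
  is_triangulation
    (regular_subdivision (edges support_graph) (@root_point R d n)
       (fun e => fine (A e.1 e.2))).

(* Subsets of R^d / R1 are represented by their preimages in R^d, which are
   the subsets of R^d stable under translation by multiples of 1. *)

Definition sector (i : 'I_d) (k : 'I_n) : set 'rV[R]_d :=
  [set p | forall j, ((p 0 j)%:E - A j k <= (p 0 i)%:E - A i k)%E].

Definition fine_type (p : 'rV[R]_d) : bigraph d n :=
  \matrix_(i, k) ((A i k \is a fin_num) && `[< sector i k p >]).

Definition cell (T : bigraph d n) : set 'rV[R]_d :=
  [set q | forall i k, (T i k <= fine_type q i k)%N].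

Definition tropical_complex : set (set 'rV[R]_d) :=
  [set cell T | T in range fine_type].

Definition saturation (K : set 'rV[R]_d) : set 'rV[R]_d :=
  [set q | exists2 p, K p & exists c : R, q = p + c *: const_mx 1].

(* bounded in R^d / R1, i.e. for the quotient norm *)
Definition bounded_mod1 (C : set 'rV[R]_d) : Prop :=
  exists2 K : set 'rV[R]_d, bounded_set K & C `<=` saturation K.

(* a single point of R^d / R1 *)
Definition point_mod1 (C : set 'rV[R]_d) : Prop :=
  exists p : 'rV[R]_d, C = saturation [set p].

Definition bounded_complex : set (set 'rV[R]_d) :=
  [set C | tropical_complex C /\ bounded_mod1 C].

Definition bounded_vertices : set (set 'rV[R]_d) :=
  [set C | bounded_complex C /\ point_mod1 C].

Definition vertex_types : {set bigraph d n} :=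
  finset (fun T : bigraph d n =>
    `[< range fine_type T /\ bounded_vertices (cell T) >]).

End TropicalArrangement.

(* Main.v *)
Require Import Defs.
From HB Require Import structures.
From mathcomp Require Import all_boot all_order all_algebra.
From mathcomp Require Import all_classical all_reals all_analysis.
From mathcomp Require Import measurable_realfun ring lra.

(** The formula reads the volume off a subdivision of [P_B] whose cells are
    Minkowski sums of faces of simplices, and linear programming duality
    produces this subdivision together with the tropical arrangement.

    A point [x] lies in [P_B] exactly when it is the vector of row sums of a
    transport plan: a nonnegative matrix [y] supported on [B] whose columns sum
    to 1 (column [k] is a point of the simplex on [N_k(B)]).  Give the edge
    [(i, k)] the cost [a_ik].  A plan of least cost comes with dual potentials,
    and complementary slackness says that it is supported on the fine type of a
    point [p]; hence the polytopes [P_T], [T] a fine type, cover [P_B]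
    ([transport_cover]).  Conversely, any plan supported on the fine type of [p]
    is optimal, so its cost is [p.x] minus a constant that depends on [p] only.
    A point [x] common to [P_T(p)] and [P_T(p')] therefore satisfies a linear
    equation with left-hand side [(p - p').x] ([fine_type_overlap]).  Unless [p]
    and [p'] agree modulo the all-ones vector this equation cuts out a null set
    of the hyperplane [sum_i x_i = n].  So distinct fine types have almost
    disjoint cells; and a fine type [T] that is not a vertex satisfies
    [T <= T(p')] for some [p'] different from [p], so that [P_T] is itself null.
    The volume of [P_B] is thus the sum of the volumes of [P_T] over the vertex
    types [T].

    It remains to compute these volumes.  The functional with coordinates
    [(-p, -q, 1)], where [q_k = max_i (p_i - a_ik)], is minimized on the lifted
    root polytope along the lifted edges of [T(p)].  By genericity the roots of
    [T(p)] then lie in a simplex and, as vertices of the root polytope, they are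
    affinely independent: [T(p)] is a forest ([fine_type_acyclic]).  At a vertex
    [T(p)] is also connected, since otherwise [p] could be moved along one
    component ([vertex_type_connected]).  Root this spanning tree at the last
    left node.  The plans supported on it are parametrized by the entries on the
    edges from the other left nodes to their parents, which range over a product
    of corner simplices [{y >= 0, sum y <= 1}], one of dimension [deg k - 1] for
    each right node [k]; its volume is the product of the [1/(deg k - 1)!]
    ([lebesgue_corner_product]).  Passing from these entries to row sums adds to
    each coordinate a function of coordinates farther from the root, so it is a
    composite of shears and preserves volume ([lebesgue_tuple_triangular]).

    Measurability of all these cells, as well as the strong duality above, comes
    from Fourier-Motzkin elimination with multipliers that do not depend on the
    right-hand side of the system ([fourier_motzkin]). *)

Set Implicit Arguments.
Unset Strict Implicit.
Unset Printing Implicit Defensive.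
Import Order.TTheory GRing.Theory Num.Theory.
Import numFieldNormedType.Exports.
Local Open Scope classical_set_scope.
Local Open Scope ring_scope.

(** * Lebesgue measure on tuples *)
Section LebesgueTuple.
Variable R : realType.
Local Notation mu := (@lebesgue_measure R).
Implicit Types m : nat.

Lemma measurable_consT m : measurable_fun [set: R * m.-tuple R]
  (fun z => [tuple of z.1 :: z.2] : m.+1.-tuple R).
Proof.
by apply: measurable_cons; [exact: measurable_fst|exact: measurable_snd].
Qed.

Lemma measurable_unconsT m : measurable_fun [set: m.+1.-tuple R]
  (fun x => (thead x, [tuple of behead x]) : R * m.-tuple R).
Proof.
apply/measurable_fun_pairP; split => /=.
- exact: measurable_tnth.
- exact: measurable_behead.
Qed.

Section ConsMeasure.
Variables (m : nat) (nu : {sigma_finite_measure set (m.-tuple R) -> \bar R}).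

(** The successor step of [lebesgue_tuple], for an arbitrary measure [nu] on the
    tails: as it preserves sigma-finite measures, [lebesgue_tuple] is one, by
    induction on the length. *)
Definition cons_measure : set (m.+1.-tuple R) -> \bar R :=
  pushforward (mu \x nu)%E (fun z => [tuple of z.1 :: z.2]).

Let cons_measure_is_measure :
  exists nu' : {measure set (m.+1.-tuple R) -> \bar R},
    (nu' : set _ -> \bar R) = cons_measure.
Proof.
pose c := fun z : R * m.-tuple R => [tuple of z.1 :: z.2] : m.+1.-tuple R.
have mc : measurable_fun setT c by exact: measurable_consT.
by unshelve eexists (pushforward (mu \x nu)%E c).
Qed.

Let cons_measure0 : cons_measure set0 = 0%E.
Proof. by have [nu' <-] := cons_measure_is_measure; exact: measure0. Qed.

Let cons_measure_ge0 X : (0 <= cons_measure X)%E.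
Proof. by have [nu' <-] := cons_measure_is_measure; exact: measure_ge0. Qed.

Let cons_measure_semi_sigma_additive : semi_sigma_additive cons_measure.
Proof.
have [nu' <-] := cons_measure_is_measure.
exact: measure_semi_sigma_additive.
Qed.

HB.instance Definition _ := isMeasure.Build _ _ _ cons_measure
  cons_measure0 cons_measure_ge0 cons_measure_semi_sigma_additive.

Lemma cons_measure_sigma_finite : sigma_finite setT cons_measure.
Proof.
have /sigma_finiteP[F [TF ndF Foo]] := sigma_finiteT mu.
have /sigma_finiteP[G [TG ndG Goo]] := sigma_finiteT nu.
pose u := fun x : m.+1.-tuple R => (thead x, [tuple of behead x]).
exists (fun n => u @^-1` (F n `*` G n)).
  apply/esym/seteqP; split => // x _.
  have [i _ Fi] : (\bigcup_i F i) (u x).1 by rewrite -TF.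
  have [j _ Gj] : (\bigcup_j G j) (u x).2 by rewrite -TG.
  exists (maxn i j) => //; split.
  - by move: Fi; exact/subsetPset/ndF/leq_maxl.
  - by move: Gj; exact/subsetPset/ndG/leq_maxr.
move=> n; have [mF Fn] := Foo n; have [mG Gn] := Goo n; split.
  rewrite -[X in measurable X]setTI.
  by apply: measurable_unconsT => //; exact: measurableX.
rewrite /cons_measure /pushforward (_ : _ @^-1` _ = F n `*` G n)//.
  have -> : (mu \x nu)%E (F n `*` G n) = (mu (F n) * nu (G n))%E.
    exact: product_measure1E.
  by rewrite lte_mul_pinfty// ge0_fin_numE.
have E (z : R * m.-tuple R) : u [tuple of z.1 :: z.2] = z.
  by case: z => a b; congr pair; apply/val_inj.
by apply/seteqP; split => z; rewrite /preimage /mkset E.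
Qed.

HB.instance Definition _ := Measure_isSigmaFinite.Build _ _ _ cons_measure
  cons_measure_sigma_finite.

End ConsMeasure.

Lemma lebesgue_tuple_is_measure m :
  exists nu : {sigma_finite_measure set (m.-tuple R) -> \bar R},
    (nu : set _ -> \bar R) = @lebesgue_tuple R m.
Proof.
elim: m => [|m [nu nuE]].
  by exists (\d_([tuple] : 0.-tuple R)).
by exists (cons_measure nu); rewrite /= -nuE.
Qed.

Lemma lebesgue_tuple0 m : lebesgue_tuple (set0 : set (m.-tuple R)) = 0%E.
Proof. by have [nu <-] := lebesgue_tuple_is_measure m; exact: measure0. Qed.

Lemma lebesgue_tuple_ge0 m (X : set (m.-tuple R)) : (0 <= lebesgue_tuple X)%E.
Proof. by have [nu <-] := lebesgue_tuple_is_measure m; exact: measure_ge0. Qed.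

Lemma lebesgue_tuple_semi_sigma_additive m :
  semi_sigma_additive (@lebesgue_tuple R m).
Proof.
by have [nu <-] := lebesgue_tuple_is_measure m; exact: measure_semi_sigma_additive.
Qed.

HB.instance Definition _ m := isMeasure.Build _ _ _ (@lebesgue_tuple R m)
  (@lebesgue_tuple0 m) (@lebesgue_tuple_ge0 m)
  (@lebesgue_tuple_semi_sigma_additive m).

Lemma lebesgue_tuple_sigma_finite m : sigma_finite setT (@lebesgue_tuple R m).
Proof.
by have [nu <-] := lebesgue_tuple_is_measure m; exact: sigma_finiteT.
Qed.

HB.instance Definition _ m := Measure_isSigmaFinite.Build _ _ _
  (@lebesgue_tuple R m)
  (@lebesgue_tuple_sigma_finite m).

Lemma lebesgue_tupleS m (X : set (m.+1.-tuple R)) :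
  lebesgue_tuple X =
  (\int[mu]_t lebesgue_tuple [set y : m.-tuple R | X [tuple of t :: y]])%E.
Proof.
apply: eq_integral => t _ /=; congr lebesgue_tuple.
by apply/seteqP; split => y; rewrite /xsection /= in_setE.
Qed.

(** Slicing along the first coordinate is the definition; slicing along lines
    parallel to it is Tonelli's theorem. *)
Lemma lebesgue_tupleS_swap m (X : set (m.+1.-tuple R)) : measurable X ->
  lebesgue_tuple X =
  (\int[@lebesgue_tuple R m]_y mu [set t : R | X [tuple of t :: y]])%E.
Proof.
move=> mX.
pose Y := [set z : R * m.-tuple R | X [tuple of z.1 :: z.2]].
have mY : measurable Y.
  by have := @measurable_consT m measurableT X mX; rewrite setTI.
have := indic_fubini_tonelli mu (@lebesgue_tuple R m) mY.
rewrite indic_fubini_tonelli_FE// indic_fubini_tonelli_GE// => E.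
rewrite [LHS]E; apply: eq_integral => t _ /=; congr (mu _).
by apply/seteqP; split => y; rewrite /ysection /= in_setE.
Qed.

(** The translate of the measure agrees with it on half-open intervals, and these
    determine it. *)
Lemma lebesgue_measure_shift (a : R) (X : set R) : measurable X ->
  mu [set t | X (t + a)] = mu X.
Proof.
move=> mX.
pose f : measurableTypeR R -> measurableTypeR R := fun t : R => t + a.
have mf : measurable_fun setT f by exact: measurable_funD.
have [Q QE] : exists Q : {measure set (measurableTypeR R) -> \bar R},
    (Q : set _ -> \bar R) = pushforward mu f.
  by unshelve eexists (pushforward mu f).
transitivity (Q X); first by rewrite QE.
apply/esym; apply: (@lebesgue_measure_unique R Q) => // _ [[b c]] /= _ <-.
rewrite QE /pushforward (_ : _ @^-1` _ = `]b - a, c - a]%classic).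
  rewrite !lebesgue_measure_itv /= !lte_fin ltrD2r; case: ifP => // _.
  by rewrite -!EFinB; congr EFin; lra.
by apply/seteqP; split => t /=; rewrite /f !in_itv/= ltrBlDr lerBrDr.
Qed.

End LebesgueTuple.

(** * Measurability of maps and sets of tuples *)
Section TupleMeasurability.
Variable R : realType.

Lemma measurable_tuple_section m (t : R) (X : set (m.+1.-tuple R)) :
  measurable X -> measurable [set y : m.-tuple R | X [tuple of t :: y]].
Proof.
move=> mX; rewrite -[X in measurable X]setTI.
by apply: (@measurable_cons _ _ _ _ (cst t) m id).
Qed.

Lemma measurable_tuple_line m (y : m.-tuple R) (X : set (m.+1.-tuple R)) :
  measurable X -> measurable [set t : R | X [tuple of t :: y]].
Proof.
move=> mX; rewrite -[X in measurable X]setTI.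
by apply: (@measurable_cons _ _ _ _ id m (cst y)).
Qed.

Lemma measurable_tuple_map m n (f : 'I_n -> m.-tuple R -> R) :
  (forall i, measurable_fun setT (f i)) ->
  measurable_fun setT (fun x => [tuple f i x | i < n]).
Proof.
move=> mf; apply/measurable_fun_tnthP => i.
by rewrite (_ : _ \o _ = f i)//; apply/funext => x /=; rewrite tnth_mktuple.
Qed.

Lemma measurable_sum_cond d (T : measurableType d) (I : finType) (P : pred I)
    (f : I -> T -> R) : (forall i, measurable_fun setT (f i)) ->
  measurable_fun setT (fun x => \sum_(i | P i) f i x).
Proof.
move=> mf; under eq_fun do rewrite big_mkcond.
by apply: measurable_sum => i; case: (P i).
Qed.

Lemma measurable_affine m (c : 'I_m -> R) b :
  measurable_fun setT (fun x : m.-tuple R => b + \sum_i c i * tnth x i).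
Proof.
apply: measurable_funD => //; apply: measurable_sum => i.
by apply: measurable_funM => //; exact: measurable_tnth.
Qed.

Lemma measurable_le_set d (T : measurableType d) (f g : T -> R) :
  measurable_fun setT f -> measurable_fun setT g ->
  measurable [set x | f x <= g x].
Proof.
by move=> mf mg; have := measurable_fun_ler mf mg measurableT (Y := [set true]);
  rewrite setTI; apply.
Qed.

Lemma measurable_forall d (T : measurableType d) (I : finType)
    (P : I -> set T) :
  (forall i, measurable (P i)) -> measurable [set x | forall i, P i x].
Proof.
move=> mP; rewrite (_ : [set _ | _] = \bigcap_(i in [set: I]) P i).
  by apply: fin_bigcap_measurable => //; exact: finite_finset.
by apply/seteqP; split => x /= H i //; exact: H.
Qed.

End TupleMeasurability.

(** * Volume-preserving triangular maps *)
Section Shears.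
Variable R : realType.

Definition shear m (i : 'I_m) (phi : m.-tuple R -> R) (x : m.-tuple R) :=
  [tuple tnth x j + (if j == i then phi x else 0) | j < m].

Definition ignores m (i : 'I_m) (phi : m.-tuple R -> R) :=
  forall x y, (forall j, j != i -> tnth x j = tnth y j) -> phi x = phi y.

Lemma measurable_shear m (i : 'I_m) phi :
  measurable_fun setT phi -> measurable_fun setT (shear i phi).
Proof.
move=> mphi; apply: measurable_tuple_map => j; apply: measurable_funD.
  exact: measurable_tnth.
by case: eqP.
Qed.

(** A shear in the first coordinate translates every line parallel to the first
    axis, by Tonelli; a shear in another coordinate restricts to a shear of each
    slice with fixed first coordinate, by induction. *)
Lemma lebesgue_tuple_shear m (i : 'I_m) phi (X : set (m.-tuple R)) :
  measurable_fun setT phi -> ignores i phi -> measurable X ->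
  lebesgue_tuple [set x | X (shear i phi x)] = lebesgue_tuple X.
Proof.
elim: m i phi X => [|m IH] i phi X mphi iphi mX; first by case: i iphi.
have [i'|] := unliftP ord0 i => [|ei]; last first.
  have mS : measurable [set x | X (shear i phi x)].
    by rewrite -[X in measurable X]setTI; exact: measurable_shear.
  rewrite !lebesgue_tupleS_swap//; apply: eq_integral => y _.
  rewrite -[RHS](@lebesgue_measure_shift _ (phi [tuple of 0 :: y])); last first.
    exact: measurable_tuple_line.
  congr (lebesgue_measure _); apply/seteqP.
  suff E (t : R) : shear i phi [tuple of t :: y] =
      [tuple of t + phi [tuple of 0 :: y] :: y].
    by split => t /=; rewrite E.
  apply: eq_from_tnth => j; rewrite tnth_mktuple ei.
  have [j'|] := unliftP ord0 j => ->.
    by rewrite !tnthS /= addr0.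
  rewrite eqxx !tnth0; congr (_ + _); apply: iphi => k.
  by have [k'|] := unliftP ord0 k => ->; rewrite ?ei ?eqxx// !tnthS.
move=> ei; rewrite !lebesgue_tupleS; apply: eq_integral => t _.
rewrite -[RHS](IH i' (fun y : m.-tuple R => phi [tuple of (t : R) :: y]));
  last 3 first.
- apply: (measurableT_comp mphi).
  by apply: (@measurable_cons _ _ _ _ (cst t) m id).
- move=> x y xy; apply: iphi => j.
  have [j'|] := unliftP ord0 j => ->; last by rewrite !tnth0.
  by rewrite ei (inj_eq lift_inj) !tnthS; exact: xy.
- exact: measurable_tuple_section.
congr (lebesgue_tuple _); apply/seteqP.
suff E (y : m.-tuple R) : shear i phi [tuple of t :: y] =
    [tuple of t :: shear i' (fun y : m.-tuple R => phi [tuple of (t : R) :: y]) y].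
  by split => y /=; rewrite E.
apply: eq_from_tnth => j; rewrite tnth_mktuple ei.
have [j'|] := unliftP ord0 j => ->.
  by rewrite !tnthS tnth_mktuple (inj_eq lift_inj).
by rewrite !tnth0 /= addr0.
Qed.

Lemma shearK m (i : 'I_m) phi : ignores i phi ->
  cancel (shear i phi) (shear i (fun x => - phi x)).
Proof.
move=> iphi x; apply: eq_from_tnth => j; rewrite !tnth_mktuple.
case: eqP => [_|_]; last by rewrite !addr0.
rewrite (iphi (shear i phi x) x) ?addrK// => k /negPf ki.
by rewrite tnth_mktuple ki addr0.
Qed.

(** The image under a shear is the preimage under the opposite shear, hence its
    measurability. *)
Lemma lebesgue_tuple_shear_image m (i : 'I_m) phi (X : set (m.-tuple R)) :
  measurable_fun setT phi -> ignores i phi -> measurable X ->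
  measurable (shear i phi @` X) /\
  lebesgue_tuple (shear i phi @` X) = lebesgue_tuple X.
Proof.
move=> mphi iphi mX.
have mN : measurable_fun setT (fun x => - phi x) by exact: measurableT_comp.
have iN : ignores i (fun x => - phi x) by move=> x y xy; rewrite (iphi x y).
have -> : shear i phi @` X = [set x | X (shear i (fun x => - phi x) x)].
  apply/seteqP; split => [_ [x Xx <-]|x /= Xx].
    by rewrite /= (shearK iphi).
  exists (shear i (fun x => - phi x) x) => //.
  rewrite -[RHS](shearK iN); congr (shear _ _ _).
  by apply/funext => y; rewrite opprK.
split; last exact: lebesgue_tuple_shear.
by rewrite -[X in measurable X]setTI; exact: measurable_shear.
Qed.

(** Processing the coordinates by increasing rank writes the map as a composite
    of shears: when coordinate [i] is modified, the coordinates of larger rank on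
    which [phi i] depends still have their original values. *)
Lemma lebesgue_tuple_triangular m (rho : 'I_m -> nat)
    (phi : 'I_m -> m.-tuple R -> R) (K : set (m.-tuple R)) :
  (forall i, measurable_fun setT (phi i)) ->
  (forall i x y, (forall j, (rho i < rho j)%N -> tnth x j = tnth y j) ->
     phi i x = phi i y) ->
  measurable K ->
  let F x := [tuple tnth x i + phi i x | i < m] in
  measurable (F @` K) /\ lebesgue_tuple (F @` K) = lebesgue_tuple K.
Proof.
move=> mphi hphi mK.
pose Fs (s : seq 'I_m) x :=
  [tuple tnth x i + (if i \in s then phi i x else 0) | i < m].
pose e : rel 'I_m := relpre rho leq.
have e_trans : transitive e by move=> j i k; exact: leq_trans.
have e_total : total e by move=> i j; exact: leq_total.
pose s := sort e (enum 'I_m).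
have us : uniq s by rewrite sort_uniq enum_uniq.
have ps : pairwise e s.
  by rewrite -sorted_pairwise//; exact: sort_sorted.
move=> F; have {F} -> : F = Fs s.
  apply/funext => x; apply: eq_from_tnth => i.
  by rewrite !tnth_mktuple mem_sort mem_enum.
elim/last_ind: s us ps => [|s i IH].
  move=> _ _; suff -> : Fs [::] @` K = K by []; apply/seteqP.
  have E x : Fs [::] x = x.
    by apply: eq_from_tnth => i; rewrite tnth_mktuple addr0.
  by split => [_ [x Kx <-]|x Kx]; [rewrite E|exists x].
rewrite rcons_uniq pairwise_rcons => /andP[nis us] /andP[/allP ls ps].
have [mF lF] := IH us ps.
have ii : ignores i (phi i).
  move=> x y xy; apply: hphi => j ij; apply: xy.
  by apply: contraTneq ij => ->; rewrite ltnn.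
have [mS lS] := lebesgue_tuple_shear_image (mphi i) ii mF.
rewrite -lF -lS.
suff E : Fs (rcons s i) @` K = shear i (phi i) @` (Fs s @` K).
  by rewrite E.
rewrite image_comp; apply: eq_imagel => x _.
apply: eq_from_tnth => j; rewrite /= !tnth_mktuple mem_rcons in_cons.
have [->|ji] := eqVneq j i; last by rewrite addr0.
rewrite /= (negPf nis) addr0; congr (_ + _); apply: hphi => k ik.
rewrite tnth_mktuple ifF ?addr0//; apply/negP => /ls /=.
by rewrite /e /= leqNgt ik.
Qed.

End Shears.

(** * Hyperplanes are null *)
Section Hyperplanes.
Variable R : realType.

Lemma measurable_hyperplane m (c : 'I_m -> R) b :
  measurable [set x : m.-tuple R | \sum_i c i * tnth x i = b].
Proof.
rewrite (_ : [set _ | _] =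
    (fun x : m.-tuple R => 0 + \sum_i c i * tnth x i) @^-1` [set b]).
  by rewrite -[X in measurable X]setTI; apply: measurable_affine.
by apply/seteqP; split => x /=; rewrite add0r.
Qed.

(** If some coefficient beyond the first is nonzero, every slice is a hyperplane
    and the induction applies; otherwise the lines parallel to the first axis
    meet the set in single points. *)
Lemma lebesgue_tuple_hyperplane m (c : 'I_m -> R) b i : c i != 0 ->
  lebesgue_tuple [set x : m.-tuple R | \sum_i c i * tnth x i = b] = 0%E.
Proof.
elim: m c b i => [|m IH] c b i ci; first by case: i ci.
have sumE (t : R) (y : m.-tuple R) :
    \sum_i c i * tnth [tuple of t :: y] i =
    c ord0 * t + \sum_i c (lift ord0 i) * tnth y i.
  by rewrite big_ord_recl tnth0; under eq_bigr do rewrite tnthS.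
have [[j cj]|c0] := pselect (exists j : 'I_m, c (lift ord0 j) != 0).
  rewrite lebesgue_tupleS integral0_eq// => t _.
  rewrite -[RHS](IH (fun j => c (lift ord0 j)) (b - c ord0 * t) j cj).
  congr (lebesgue_tuple _); apply/seteqP.
  split => y /=; rewrite sumE; first by move=> <-; rewrite addrC addKr.
  by move=> ->; rewrite addrC subrK.
have c0' j : c (lift ord0 j) = 0.
  by apply/eqP/negPn/negP => cj; apply: c0; exists j.
rewrite lebesgue_tupleS_swap; last exact: measurable_hyperplane.
rewrite integral0_eq// => y _.
rewrite (_ : [set _ | _] = [set b / c ord0]) ?lebesgue_measure_set1//.
have c00 : c ord0 != 0.
  by move: ci; have [j|] := unliftP ord0 i => ->//; rewrite c0' eqxx.
apply/seteqP; split => t /=; rewrite sumE big1 ?addr0;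
  try by move=> *; rewrite c0' mul0r.
  by move=> <-; rewrite mulrC mulKf.
by move=> ->; rewrite mulrC divfK.
Qed.

End Hyperplanes.

(** * Volume of a product of corner simplices *)
Section CornerProduct.
Variable R : realType.

Definition block_size m (J : finType) (kap : 'I_m -> J) k : nat :=
  \sum_(i < m) (kap i == k).

(** The product over [k] of the simplices [{y >= 0, sum y <= s k}] in the
    coordinates of the block [kap^-1 k].  The blocks may be interleaved in the
    order of the coordinates, and the sizes [s k] vary so that slices are again
    of this form. *)
Definition corner_product m (J : finType) (kap : 'I_m -> J) (s : J -> R) :
    set (m.-tuple R) :=
  [set y | (forall i, 0 <= tnth y i) /\
           (forall k, \sum_(i | kap i == k) tnth y i <= s k)].

Lemma measurable_corner_product m (J : finType) (kap : 'I_m -> J) s :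
  measurable (corner_product kap s).
Proof.
apply: measurableI.
  by apply: measurable_forall => i; apply: measurable_le_set => //;
    exact: measurable_tnth.
apply: measurable_forall => k; apply: measurable_le_set => //.
rewrite (_ : (fun _ => _) =
   (fun x : m.-tuple R => 0 + \sum_i (kap i == k)%:R * tnth x i)).
  exact: measurable_affine.
apply/funext => x; rewrite add0r big_mkcond/=; apply: eq_bigr => i _.
by case: eqP; rewrite ?mul1r ?mul0r.
Qed.

Lemma integral_power_simplex (a C : R) n : 0 <= a ->
  (\int[@lebesgue_measure R]_(t in `[0%R, a]) (C * ((a - t) ^+ n / n`!%:R))%:E)%E
  = (C * (a ^+ n.+1 / n.+1`!%:R))%:E.
Proof.
rewrite le_eqVlt => /predU1P[<-|a0].
  by rewrite set_itv1 integral_set1 expr0n/= mul0r mulr0.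
pose c := C / n.+1`!%:R.
pose F := fun t : R => - c * (a - t) ^+ n.+1.
have dF (x : R) : is_derive x 1 F (C * ((a - x) ^+ n / n`!%:R)).
  have d1 : is_derive x 1 (fun t : R => a - t) (-1).
    rewrite -[-1]sub0r; exact: is_deriveB.
  have d2 := is_deriveX n.+1 d1.
  have d3 := is_deriveZ (- c) d2.
  have -> : C * ((a - x) ^+ n / n`!%:R) =
      - c *: ((n.+1%:R * (a - x) ^+ n) *: (-1 : R)).
    rewrite /c factS natrM /GRing.scale/=; field.
    rewrite pnatr_eq0 -lt0n fact_gt0/=.
    by rewrite -[1]/(1%:R) -natrD pnatr_eq0.
  suff -> : F = - c \*: ((fun t : R => a - t) ^+ n.+1) by exact: d3.
  by apply/funext => t; rewrite exprfctE.
have cF : continuous F.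
  by move=> x; apply/differentiable_continuous/derivable1_diffP; have [] := dF x.
rewrite (@continuous_FTC2 _ _ F)//.
- rewrite /F /c subrr subr0 expr0n/= mulr0 -EFinB; congr EFin.
  by rewrite sub0r mulNr opprK -!mulrA; congr (_ * _); rewrite mulrC.
- apply: continuous_subspaceT.
  move=> x; apply: cvgM; first exact: cvg_cst.
  apply: cvgM; last exact: cvg_cst.
  apply: (@continuous_comp _ _ _ (fun t : R => a - t) (fun u => u ^+ n)).
    by apply: cvgB; [exact: cvg_cst|exact: cvg_id].
  exact: exprn_continuous.
- split.
  + by move=> x _; have [] := dF x.
  + apply: cvg_at_right_filter; exact: cF.
  + apply: cvg_at_left_filter; exact: cF.
- by move=> x _; rewrite derive1E; apply: derive_val.
Qed.

(** The slice at [t] of the first coordinate, which belongs to block [k0], is the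
    same kind of set with [s k0] decreased by [t]; integrating the power of
    [s k0 - t] raises the exponent of block [k0] by one. *)
Lemma lebesgue_corner_product m (J : finType) (kap : 'I_m -> J) (s : J -> R) :
  (forall k, 0 <= s k) ->
  lebesgue_tuple (corner_product kap s) =
  (\prod_k (s k ^+ block_size kap k / (block_size kap k)`!%:R))%:E.
Proof.
elim: m kap s => [|m IH] kap s s0.
  rewrite /= diracE mem_set/=.
    by rewrite big1// => k _; rewrite /block_size big_ord0 expr0 fact0 divr1.
  by split=> [[]//|k]; rewrite big_pred0// => -[].
pose k0 := kap ord0; pose kap' i := kap (lift ord0 i).
pose s' t k := if k == k0 then s k - t else s k.
have bS k : block_size kap k = ((k == k0) + block_size kap' k)%N.
  by rewrite /block_size big_ord_recl eq_sym.
have secE (t : R) :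
    [set y : m.-tuple R | corner_product kap s [tuple of t :: y]] =
    if t \in `[0, s k0] then corner_product kap' (s' t) else set0.
  have sumE k (y : m.-tuple R) :
      \sum_(i | kap i == k) tnth [tuple of t :: y] i =
      (if k == k0 then t else 0) + \sum_(i | kap' i == k) tnth y i.
    rewrite big_mkcond big_ord_recl tnth0 /= eq_sym; congr (_ + _).
    rewrite [RHS]big_mkcond; apply: eq_bigr => i _.
    by rewrite tnthS.
  apply/seteqP; split => y /=.
    move=> [y0 ys]; have t0 : 0 <= t by have := y0 ord0; rewrite tnth0.
    have y0' i : 0 <= tnth y i by have := y0 (lift ord0 i); rewrite tnthS.
    have ts : t <= s k0.
      apply: le_trans (ys k0); rewrite sumE eqxx lerDl.
      by apply: sumr_ge0.
    rewrite in_itv/= t0 ts; split => // k.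
    have := ys k; rewrite sumE /s'; case: eqP => _; last by rewrite add0r.
    by rewrite lerBrDl.
  case: ifPn => //; rewrite in_itv/= => /andP[t0 ts] [y0 ys]; split.
    by move=> i; have [j|] := unliftP ord0 i => ->; rewrite ?tnth0 ?tnthS.
  move=> k; rewrite sumE; have := ys k; rewrite /s'.
  by case: eqP => _; rewrite ?add0r// lerBrDl.
pose C :=
  \prod_(k | k != k0) (s k ^+ block_size kap k / (block_size kap k)`!%:R).
pose n := block_size kap' k0.
rewrite lebesgue_tupleS.
transitivity (\int[@lebesgue_measure R]_(t in `[0%R, s k0])
    (C * ((s k0 - t) ^+ n / n`!%:R))%:E)%E.
  rewrite [RHS]integral_mkcond; apply: eq_integral => t _.
  rewrite secE patchE mem_setE; case: ifPn => [ti|_]; last exact: measure0.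
  rewrite IH; last first.
    move=> k; rewrite /s'; case: eqP => [->|//].
    by move: ti; rewrite in_itv/= subr_ge0 => /andP[].
  rewrite (bigD1 k0)//= mulrC /s' eqxx; congr (_ * _)%:E.
  by apply: eq_bigr => k /negPf kk0; rewrite kk0 bS kk0.
rewrite integral_power_simplex// [in RHS](bigD1 k0)//= mulrC.
by rewrite bS eqxx.
Qed.

End CornerProduct.

(** * Fourier-Motzkin elimination *)
Section FourierMotzkin.
Variable F : realFieldType.

(** One variable: the least of the upper bounds [r i / c i] works, or else the
    greatest of the lower bounds when there is no upper bound. *)
Lemma separating_point (I : finType) (c r : I -> F) :
  (forall i, c i = 0 -> 0 <= r i) ->
  (forall i j, 0 < c i -> c j < 0 -> r j / c j <= r i / c i) ->
  exists x, forall i, c i * x <= r i.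
Proof.
move=> r0 rij.
have [i0 ci0|noP] := pickP (fun i => 0 < c i).
  case: (@Order.TotalTheory.arg_minP _ _ I i0
    (fun i => 0 < c i) (fun i => r i / c i) ci0).
  move=> i ci imin; exists (r i / c i) => j.
  have [cj|cj|cj] := ltgtP (c j) 0.
  - by rewrite mulrC -ler_ndivrMr//; exact: rij.
  - by rewrite mulrC -ler_pdivlMr//; exact: imin.
  - by rewrite cj mul0r; exact: r0.
have [i0 ci0|noN] := pickP (fun i => c i < 0).
  case: (@Order.TotalTheory.arg_maxP _ _ I i0
    (fun i => c i < 0) (fun i => r i / c i) ci0).
  move=> i ci imax; exists (r i / c i) => j.
  have [cj|cj|cj] := ltgtP (c j) 0.
  - by rewrite mulrC -ler_ndivrMr//; exact: imax.
  - by have := noP j; rewrite cj.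
  - by rewrite cj mul0r; exact: r0.
exists 0 => j; rewrite mulr0; apply: r0.
by apply/eqP; rewrite eq_le !leNgt (noP j) (noN j).
Qed.

(** Gale's theorem with a finite list of multipliers that serves all right-hand
    sides [b] at once: for fixed [L], solvability of [L x <= b] is a finite
    system of linear inequalities in [b].  Eliminating the first variable replaces
    the constraints by the nonnegative combinations [u (i, j)] of two of them in
    which this variable cancels. *)
Lemma fourier_motzkin m (I : finType) (L : I -> 'I_m -> F) :
  exists W : seq {ffun I -> F},
    (forall w, w \in W ->
       (forall i, 0 <= w i) /\ (forall j, \sum_i w i * L i j = 0)) /\
    (forall b : I -> F, (forall w, w \in W -> 0 <= \sum_i w i * b i) ->
       exists x : 'I_m -> F, forall i, \sum_j L i j * x j <= b i).
Proof.
elim: m I L => [|m IH] I L.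
  exists [seq [ffun i => (i == j)%:R] | j <- enum I]; split.
    move=> _ /mapP[j _ ->]; split=> [i|[]//].
    by rewrite ffunE ler0n.
  move=> b bW; exists (fun=> 0) => i; rewrite big_ord0.
  have /bW : [ffun i' => (i' == i)%:R] \in
      [seq [ffun i => (i == j)%:R : F] | j <- enum I].
    by apply/mapP; exists i => //; rewrite mem_enum.
  rewrite (bigD1 i)//= big1 ?addr0 ?ffunE ?eqxx ?mul1r// => j /negPf ji.
  by rewrite ffunE ji mul0r.
pose c i := L i ord0.
pose u (p : I * I) l : F :=
  if (0 < c p.1) && (c p.2 < 0) then (l == p.1)%:R * - c p.2 + (l == p.2)%:R * c p.1
  else if (c p.1 == 0) && (p.1 == p.2) then (l == p.1)%:R else 0.
have sum1 p (f : I -> F) : \sum_l (l == p)%:R * f l = f p.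
  rewrite (bigD1 p)//= eqxx mul1r big1 ?addr0// => j /negPf ->.
  by rewrite mul0r.
have sumu p (f : I -> F) : \sum_l u p l * f l =
    if (0 < c p.1) && (c p.2 < 0) then - c p.2 * f p.1 + c p.1 * f p.2
    else if (c p.1 == 0) && (p.1 == p.2) then f p.1 else 0.
  rewrite /u; case: ifP => _; last case: ifP => _.
  - under eq_bigr do rewrite mulrDl -!mulrA.
    by rewrite big_split/= !sum1.
  - exact: sum1.
  - by rewrite big1// => l _; rewrite mul0r.
have u0 p l : 0 <= u p l.
  rewrite /u; case: ifP => [/andP[c1 c2]|_]; last by case: ifP.
  by rewrite addr_ge0// mulr_ge0// ?oppr_ge0 ltW.
pose L' p j := \sum_l u p l * L l (lift ord0 j).
have [W' [W'1 W'2]] := IH _ L'.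
pose comb (w' : {ffun I * I -> F}) := [ffun l => \sum_p w' p * u p l].
have sumcomb w' (f : I -> F) :
    \sum_l comb w' l * f l = \sum_p w' p * \sum_l u p l * f l.
  under eq_bigr do rewrite ffunE mulr_suml.
  rewrite exchange_big/=; apply: eq_bigr => p _.
  by rewrite mulr_sumr; apply: eq_bigr => l _; rewrite mulrA.
exists [seq comb w' | w' <- W']; split.
  move=> _ /mapP[w' /W'1[w'0 w'L] ->]; split=> [l|j].
    by rewrite ffunE sumr_ge0// => p _; rewrite mulr_ge0.
  rewrite sumcomb; have [j'|] := unliftP ord0 j => ->; first exact: w'L.
  rewrite big1// => p _; rewrite sumu.
  case: ifP => _; last case: ifP => [/andP[/eqP]|_].
  - by rewrite -/(c p.1) -/(c p.2) mulNr [c p.2 * _]mulrC addNr mulr0.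
  - by rewrite /c => -> _; rewrite mulr0.
  - by rewrite mulr0.
move=> b bW.
have [|x' x'P] := W'2 (fun p => \sum_l u p l * b l).
  by move=> w' w'W; rewrite -sumcomb; apply: bW; exact: map_f.
pose r l := b l - \sum_j L l (lift ord0 j) * x' j.
have ur p : 0 <= \sum_l u p l * r l.
  under eq_bigr do rewrite mulrBr.
  rewrite sumrB subr_ge0; apply: le_trans (x'P p).
  rewrite le_eqVlt; apply/orP; left; apply/eqP.
  under eq_bigr do rewrite mulr_sumr.
  rewrite exchange_big/=; apply: eq_bigr => j _.
  by rewrite mulr_suml; apply: eq_bigr => l _; rewrite mulrA.
have [||x0 x0P] := @separating_point I c r.
- move=> i ci; have := ur (i, i); rewrite sumu/= ci ltxx/= !eqxx.
  by [].
- move=> i j ci cj; have := ur (i, j); rewrite sumu/= ci cj/= mulNr addrC subr_ge0.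
  move=> H; rewrite ler_ndivrMr// mulrAC ler_pdivrMr//.
  by rewrite mulrC [_ * c i]mulrC.
exists (fun j => oapp x' x0 (unlift ord0 j)) => i.
rewrite big_ord_recl unlift_none/=.
under eq_bigr do rewrite liftK/=.
by rewrite -lerBrDr; exact: x0P.
Qed.

Lemma fourier_motzkin_fin (J I : finType) (L : I -> J -> F) :
  exists W : seq {ffun I -> F},
    (forall w, w \in W ->
       (forall i, 0 <= w i) /\ (forall j, \sum_i w i * L i j = 0)) /\
    (forall b : I -> F, (forall w, w \in W -> 0 <= \sum_i w i * b i) ->
       exists x : J -> F, forall i, \sum_j L i j * x j <= b i).
Proof.
have [W [W1 W2]] := fourier_motzkin (fun i (j : 'I_#|J|) => L i (enum_val j)).
exists W; split.
  move=> w /W1[w0 wL]; split=> // j.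
  by have := wL (enum_rank j); rewrite enum_rankK.
move=> b /W2[x xP]; exists (x \o enum_rank) => i.
rewrite (reindex (@enum_val J xpredT))/=; last exact: onW_bij (@enum_val_bij J).
by under eq_bigr do rewrite enum_valK.
Qed.

End FourierMotzkin.

(** * Transport plans *)
Section Transport.
Variables (R : realType) (d n : nat).
Implicit Types (B : bigraph d n) (x : 'rV[R]_d) (y a : 'M[R]_(d, n)).

(** Column [k] of [y] is a point of the simplex on the neighbours of [k]; the
    sum of these points is [x]. *)
Definition transport B x y :=
  [/\ forall i k, 0 <= y i k, forall i k, ~~ B i k -> y i k = 0,
      forall i, \sum_k y i k = x 0 i & forall k, \sum_i y i k = 1].

Lemma transport_mono B B' x y : (forall i k, B i k -> B' i k) ->
  transport B x y -> transport B' x y.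
Proof.
move=> BB' [y0 yB yr yc]; split=> // i k nB'; apply: yB.
by apply: contra nB'; exact: BB'.
Qed.

(** Elimination of the plan [y] from the system saying that [y] is a transport
    plan for [x] of cost at most [t].  A multiplier has a weight [w.1.1] for the
    cost constraint and weights [w.1.2], [w.2] of arbitrary sign for the row and
    column equations. *)
Lemma transport_elimination B a :
  exists W : seq (R * 'rV[R]_d * 'rV[R]_n),
    (forall w, w \in W -> 0 <= w.1.1 /\
       forall i k, B i k -> 0 <= w.1.2 0 i + w.2 0 k + w.1.1 * a i k) /\
    (forall x t,
       (forall w, w \in W ->
          0 <= w.1.1 * t + \sum_i w.1.2 0 i * x 0 i + \sum_k w.2 0 k) ->
       exists2 y, transport B x y & \sum_i \sum_k a i k * y i k <= t).
Proof.
pose V := ('I_d + 'I_n)%type.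
pose I := ('I_d * 'I_n + V * bool + unit)%type.
pose sg (s : bool) : R := if s then 1 else -1.
pose inc (v : V) (e : 'I_d * 'I_n) : bool :=
  match v with inl i => e.1 == i | inr k => e.2 == k end.
pose L (i : I) (e : 'I_d * 'I_n) : R := match i with
  | inl (inl e') => - (e == e')%:R
  | inl (inr (v, s)) => sg s * (B e.1 e.2 && inc v e)%:R
  | inr _ => (B e.1 e.2)%:R * a e.1 e.2 end.
pose b x t (i : I) : R := match i with
  | inl (inl e') => 0
  | inl (inr (inl i, s)) => sg s * x 0 i
  | inl (inr (inr k, s)) => sg s
  | inr _ => t end.
have [W [W1 W2]] := fourier_motzkin_fin L.
pose mult (w : {ffun I -> R}) v : R :=
  w (inl (inr (v, true))) - w (inl (inr (v, false))).
pose conv (w : {ffun I -> R}) : R * 'rV[R]_d * 'rV[R]_n :=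
  (w (inr tt), \row_i mult w (inl i), \row_k mult w (inr k)).
have sumI (w : {ffun I -> R}) (f : I -> R) : \sum_i w i * f i =
   \sum_e w (inl (inl e)) * f (inl (inl e)) +
   \sum_v (w (inl (inr (v, true))) * f (inl (inr (v, true))) +
           w (inl (inr (v, false))) * f (inl (inr (v, false)))) +
   w (inr tt) * f (inr tt).
  rewrite big_sumType/= big_sumType/=; congr (_ + _ + _).
    rewrite [LHS](eq_bigr
      (fun p => w (inl (inr (p.1, p.2))) * f (inl (inr (p.1, p.2)))));
      last by case.
    rewrite -(pair_bigA _
      (fun v s => w (inl (inr (v, s))) * f (inl (inr (v, s)))))/=.
    by apply: eq_bigr => v _; rewrite big_bool.
  by rewrite (bigD1 tt)//= big1 ?addr0//; case.
exists [seq conv w | w <- W]; split.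
  move=> _ /mapP[w /W1[w0 wL] ->]; split=> //= i k Bik.
  rewrite !mxE.
  have := wL (i, k); rewrite sumI /= (bigD1 (i, k))//= eqxx.
  rewrite big1 ?addr0; last first.
    by move=> e /negPf; rewrite eq_sym => ->; rewrite oppr0 mulr0.
  rewrite big_sumType/= (bigD1 i)//= [X in _ + (_ + X)](bigD1 k)//= !eqxx Bik/=.
  rewrite big1; last first.
    by move=> j /negPf; rewrite eq_sym => ->; rewrite !mulr0 addr0.
  rewrite big1; last first.
    by move=> j /negPf; rewrite eq_sym => ->; rewrite !mulr0 addr0.
  have := w0 (inl (inl (i, k))); rewrite /mult; lra.
move=> x t H.
have [|z zP] := W2 (b x t).
  move=> w wW; rewrite sumI /= big1 ?add0r; last by move=> e _; rewrite mulr0.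
  have := H _ (map_f conv wW); rewrite /= big_sumType/=.
  move=> /le_trans; apply; rewrite le_eqVlt; apply/orP; left; apply/eqP.
  rewrite -addrA addrC; congr (_ + _ + _).
    by apply: eq_bigr => i _; rewrite mxE /mult; ring.
  by apply: eq_bigr => i _; rewrite mxE /mult; ring.
pose y : 'M[R]_(d, n) := \matrix_(i, k) ((B i k)%:R * z (i, k)).
have le_eq v (r : R) :
    (forall s, \sum_e sg s * (B e.1 e.2 && inc v e)%:R * z e <= sg s * r) ->
    \sum_(e | inc v e) (B e.1 e.2)%:R * z e = r.
  move=> Hs.
  have E s : \sum_e sg s * (B e.1 e.2 && inc v e)%:R * z e =
      sg s * \sum_(e | inc v e) (B e.1 e.2)%:R * z e.
    rewrite mulr_sumr [RHS]big_mkcond; apply: eq_bigr => e _.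
    by case: ifP => _; rewrite ?andbT ?andbF ?mulr0 ?mul0r ?mulrA.
  have := Hs true; have := Hs false; rewrite !E /= !mulN1r !mul1r lerN2.
  by move=> h1 h2; apply/le_anti; rewrite h1 h2.
exists y; first split.
- move=> i k; rewrite mxE mulr_ge0//.
  have := zP (inl (inl (i, k))) => /=.
  rewrite (bigD1 (i, k))//= eqxx mulN1r big1 ?addr0 ?oppr_le0//.
  by move=> e /negPf ->; rewrite oppr0 mul0r.
- by move=> i k /negPf Bik; rewrite mxE Bik mul0r.
- move=> i; rewrite -(le_eq (inl i) (x 0 i)); last first.
    by move=> s; exact: (zP (inl (inr (inl i, s)))).
  under eq_bigr do rewrite mxE.
  rewrite [RHS](eq_big (fun e => (e.1 == i) && true)
    (fun e => (B e.1 e.2)%:R * z (e.1, e.2))); last 2 first.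
  - by move=> e; rewrite andbT.
  - by case.
  rewrite -(pair_big (fun i' => i' == i) xpredT
    (fun i k => (B i k)%:R * z (i, k)))/=.
    by rewrite big_pred1_eq.
- move=> k; rewrite -(le_eq (inr k) 1); last first.
    by move=> s; have := (zP (inl (inr (inr k, s)))); rewrite /= mulr1.
  under eq_bigr do rewrite mxE.
  rewrite [RHS](eq_bigr (fun e => (B e.1 e.2)%:R * z (e.1, e.2))); last by case.
  rewrite -(pair_big xpredT (fun k' => k' == k)
    (fun i k => (B i k)%:R * z (i, k)))/=.
  by apply: eq_bigr => i _; rewrite big_pred1_eq.
rewrite pair_bigA/=; apply: le_trans (zP (inr tt)).
rewrite le_eqVlt; apply/orP; left; apply/eqP.
by apply: eq_bigr => e _; rewrite mxE mulrA [a _ _ * _]mulrC; case: e.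
Qed.

End Transport.

(** * Duality for the transport problem *)
Section Duality.
Variables (R : realType) (d n : nat).
Implicit Types (B : bigraph d n) (x : 'rV[R]_d) (y a : 'M[R]_(d, n)).

Lemma seq_argmax (T : eqType) (f : T -> R) (s : seq T) (z0 : T) : z0 \in s ->
  exists2 w, w \in s & forall w', w' \in s -> f w' <= f w.
Proof.
elim: s z0 => // z s IH z0 _; case: s IH => [|z' s] IH.
  by exists z; rewrite ?mem_head// => w'; rewrite inE => /eqP ->.
have [w ws wmax] := IH z' (mem_head _ _).
have [zw|wz] := leP (f z) (f w).
  exists w; first by rewrite in_cons ws orbT.
  by move=> w'; rewrite in_cons => /predU1P[->|/wmax].
exists z; first exact: mem_head.
move=> w'; rewrite in_cons => /predU1P[->//|/wmax w'w].
exact: le_trans w'w (ltW wz).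
Qed.

Lemma transport_total B x y : transport B x y -> \sum_i x 0 i = n%:R.
Proof.
move=> [_ _ xE yE]; under eq_bigr do rewrite -xE.
rewrite exchange_big/=; under eq_bigr do rewrite yE.
by rewrite sumr_const card_ord.
Qed.

(** The cost [p_i + q_k] depends on the margins of the plan only. *)
Lemma transport_pairing B x y (p : 'rV[R]_d) (q : 'rV[R]_n) :
  transport B x y ->
  \sum_i \sum_k y i k * (p 0 i + q 0 k) = \sum_i p 0 i * x 0 i + \sum_k q 0 k.
Proof.
move=> [_ _ xE yE].
under eq_bigr => i _.
  under eq_bigr do rewrite mulrDr.
  rewrite big_split/= -mulr_suml xE mulrC; over.
rewrite big_split/=; congr (_ + _); rewrite exchange_big/=.
by apply: eq_bigr => k _; rewrite -mulr_suml yE mul1r.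
Qed.

(** Strong duality and complementary slackness: an optimal plan exists, and dual
    potentials [p], [q] have nonnegative reduced cost on [B], zero reduced cost
    where the plan is positive.  The smallest feasible cost bound is the largest
    of the bounds imposed by the multipliers of positive cost weight; the
    multiplier attaining it, scaled to weight 1, is the pair of potentials. *)
Lemma transport_duality B a x y0 : transport B x y0 ->
  exists y, exists p : 'rV[R]_d, exists q : 'rV[R]_n,
    [/\ transport B x y, forall i k, B i k -> 0 <= a i k + p 0 i + q 0 k &
        forall i k, 0 < y i k -> a i k + p 0 i + q 0 k = 0].
Proof.
move=> tr0.
have [W [W1 W2]] := transport_elimination B a.
pose M := \sum_i \sum_k `|a i k|.
have aM i k : 0 <= M + a i k.
  rewrite -lerBlDr sub0r; apply: (@le_trans _ _ `|a i k|).
    by rewrite -normrN ler_norm.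
  rewrite /M (bigD1 i)//= (bigD1 k)//= -addrA lerDl addr_ge0//.
    exact: sumr_ge0.
  by apply: sumr_ge0 => j _; exact: sumr_ge0.
(* A valid multiplier of weight 1, so that some cost bound is imposed. *)
pose w0 : R * 'rV[R]_d * 'rV[R]_n := (1, 0, const_mx M).
pose W' := [seq w <- w0 :: W | 0 < w.1.1].
pose val (w : R * 'rV[R]_d * 'rV[R]_n) :=
  \sum_i w.1.2 0 i * x 0 i + \sum_k w.2 0 k.
have W'1 w : w \in w0 :: W ->
    forall i k, B i k -> 0 <= w.1.2 0 i + w.2 0 k + w.1.1 * a i k.
  rewrite in_cons => /predU1P[->|/W1[]//] i k _.
  by rewrite /= !mxE add0r mul1r.
have w0W' : w0 \in W' by rewrite mem_filter mem_head ltr01.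
have [w] := seq_argmax (fun w => - val w / w.1.1) w0W'.
rewrite mem_filter => /andP[tau0 wW] wmax.
pose t := - val w / w.1.1.
have [|y try yt] := W2 x t.
  move=> w' w'W; rewrite -addrA -/(val w').
  have [tau'0 w'0] := W1 _ w'W.
  move: tau'0; rewrite le_eqVlt => /predU1P[tau0'|tau0'].
    rewrite -tau0' mul0r add0r /val -(transport_pairing _ _ tr0).
    have [y0ge y0B _ _] := tr0.
    apply: sumr_ge0 => i _; apply: sumr_ge0 => k _.
    have [Bik|Bik] := boolP (B i k); last by rewrite y0B// mul0r.
    rewrite mulr_ge0//; have := w'0 i k Bik.
    by rewrite -tau0' mul0r addr0.
  have : w' \in W' by rewrite mem_filter tau0' in_cons w'W orbT.
  move=> /wmax; rewrite ler_pdivrMr// => h.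
  by rewrite -lerBlDr sub0r mulrC.
have [yge yB _ _] := try.
exists y, (w.1.1^-1 *: w.1.2), (w.1.1^-1 *: w.2); split=> //.
  move=> i k Bik; rewrite !mxE -(pmulr_rge0 _ tau0) !mulrDr.
  rewrite !mulVKf ?gt_eqF//.
  by have := W'1 _ wW i k Bik; rewrite addrC addrA.
have slack0 i k : 0 <= y i k * (w.1.2 0 i + w.2 0 k + w.1.1 * a i k).
  have [Bik|Bik] := boolP (B i k); last by rewrite yB// mul0r.
  by rewrite mulr_ge0//; exact: W'1.
have sum0 : \sum_i \sum_k y i k * (w.1.2 0 i + w.2 0 k + w.1.1 * a i k) <= 0.
  under eq_bigr => i _ do under eq_bigr => k _ do rewrite mulrDr.
  under eq_bigr => i _ do rewrite big_split/=.
  rewrite big_split/= (transport_pairing _ _ try) -/(val w).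
  rewrite [X in _ + X](_ : _ = w.1.1 * \sum_i \sum_k a i k * y i k); last first.
    rewrite mulr_sumr; apply: eq_bigr => i _; rewrite mulr_sumr.
    by apply: eq_bigr => k _; ring.
  have : w.1.1 * \sum_i \sum_k a i k * y i k <= w.1.1 * t.
    by rewrite ler_pM2l.
  have -> : w.1.1 * t = - val w by rewrite /t mulrC divfK ?gt_eqF.
  by move=> h; rewrite -lerBrDl sub0r.
move=> i k yik.
have : y i k * (w.1.2 0 i + w.2 0 k + w.1.1 * a i k) <= 0.
  apply: le_trans sum0.
  rewrite (bigD1 i)//= (bigD1 k)//= -[leRHS]addrA lerDl addr_ge0//.
    by apply: sumr_ge0 => k' _; exact: slack0.
  by apply: sumr_ge0 => i' _; apply: sumr_ge0 => k' _; exact: slack0.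
rewrite pmulr_rle0// => h.
have Bik : B i k by apply/negPn/negP => /yB yik0; rewrite yik0 ltxx in yik.
have E : w.1.2 0 i + w.2 0 k + w.1.1 * a i k = 0.
  by apply/le_anti; rewrite h W'1.
rewrite !mxE; apply: (mulfI (lt0r_neq0 tau0)); rewrite mulr0 -E !mulrDr.
by rewrite !mulVKf ?gt_eqF//; ring.
Qed.

End Duality.

(** * Convex hulls and generalized permutohedra *)
Section Convexity.
Variables (R : realType) (m : nat).
Implicit Types (S X : set 'rV[R]_m).

Lemma convex_setP S : (forall x y (t : R), 0 < t -> t < 1 -> S x -> S y ->
    S (t *: x + (1 - t) *: y)) -> @convex_set R 'rV[R]_m S.
Proof.
move=> SP; apply/convex_setW => x y; rewrite !inE => Sx Sy k k0 k1.
by rewrite in_setE; exact: SP.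
Qed.

Lemma convex_set_comb S x y (t : R) : @convex_set R 'rV[R]_m S ->
  0 <= t -> t <= 1 -> S x -> S y -> S (t *: x + (1 - t) *: y).
Proof.
move=> cS t0 t1 Sx Sy.
have := cS x y (Itv01 t0 t1); rewrite !in_setE => /(_ Sx Sy); exact.
Qed.

(** The normalization by the total weight makes the statement stable under
    removing terms, which the induction needs. *)
Lemma convex_set_sum S (I : eqType) (r : seq I) (w : I -> R)
    (v : I -> 'rV[R]_m) :
  @convex_set R 'rV[R]_m S -> (forall i, 0 <= w i) ->
  (forall i, 0 < w i -> S (v i)) -> 0 < \sum_(i <- r) w i ->
  S ((\sum_(i <- r) w i)^-1 *: \sum_(i <- r) w i *: v i).
Proof.
move=> cS w0 wS; elim: r => [|i r IH]; first by rewrite big_nil ltxx.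
rewrite !big_cons; set s := \sum_(j <- r) w j in IH *.
set u := \sum_(j <- r) w j *: v j in IH *.
have s0 : 0 <= s by exact: sumr_ge0.
have := w0 i; rewrite le_eqVlt => /predU1P[<-|wi0].
  by rewrite add0r scale0r add0r.
move: s0; rewrite le_eqVlt => /predU1P[s0 _|s0 _].
  have -> : u = 0.
    move/esym/eqP: s0; rewrite psumr_eq0// => /allP rw0.
    by rewrite /u big_seq big1// => j /rw0 /eqP ->; rewrite scale0r.
  by rewrite -s0 !addr0 scalerA mulVf ?gt_eqF// scale1r; exact: wS.
have t0 : 0 < w i + s by exact: addr_gt0.
rewrite scalerDr scalerA.
have -> : (w i + s)^-1 *: u = (1 - (w i + s)^-1 * w i) *: (s^-1 *: u).
  rewrite scalerA; congr (_ *: _); field.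
  by rewrite !gt_eqF.
apply: convex_set_comb => //.
- by rewrite mulr_ge0// invr_ge0 ltW.
- by rewrite mulrC ler_pdivrMr// mul1r lerDl ltW.
- exact: wS.
- exact: IH.
Qed.

Lemma convex_conv X : @convex_set R 'rV[R]_m (Defs.conv X).
Proof.
move=> x y t; rewrite !in_setE => cx cy S [cS XS].
have := cS x y t; rewrite !in_setE; apply.
  by apply: cx.
by apply: cy.
Qed.

Lemma conv_sub X S : @convex_set R 'rV[R]_m S -> X `<=` S -> Defs.conv X `<=` S.
Proof. exact: smallest_sub. Qed.

Lemma sub_conv X : X `<=` Defs.conv X.
Proof. exact: sub_gen_smallest. Qed.

End Convexity.

Section Permutohedron.
Variables (R : realType) (d n : nat).
Implicit Types (B : bigraph d n) (x : 'rV[R]_d).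

Lemma simplex_onP (I : pred 'I_d) x : @simplex_on R d [set i | I i] x <->
  [/\ forall i, 0 <= x 0 i, forall i, ~~ I i -> x 0 i = 0 & \sum_i x 0 i = 1].
Proof.
split=> [|[x0 xI x1]].
  have := @conv_sub R d [set delta_mx 0 i | i in [set i | I i]]
    [set x | [/\ forall i, 0 <= x 0 i, forall i, ~~ I i -> x 0 i = 0
      & \sum_i x 0 i = 1]].
  apply.
    apply: convex_setP => u v t t0 t1 [u0 uI u1] [v0 vI v1]; split.
    - by move=> i; rewrite !mxE addr_ge0// mulr_ge0// ?ltW// subr_gt0.
    - by move=> i Ii; rewrite !mxE uI// vI// !mulr0 addr0.
    - under eq_bigr do rewrite !mxE.
      by rewrite big_split/= -!mulr_sumr u1 v1 !mulr1 addrC subrK.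
  move=> _ [i Ii <-]; split.
  - by move=> j; rewrite mxE eqxx ler0n.
  - move=> j Ij; rewrite mxE eqxx/=; case: eqP => // ji.
    by rewrite ji Ii in Ij.
  - rewrite (bigD1 i)//= mxE !eqxx big1 ?addr0// => j /negPf ji.
    by rewrite mxE ji.
rewrite /simplex_on.
have := @convex_set_sum R d _ _ (index_enum 'I_d) (fun i => x 0 i)
  (fun i => delta_mx 0 i)
  (@convex_conv R d [set delta_mx 0 i | i in [set i | I i]]) x0.
rewrite x1 invr1 scale1r -row_sum_delta; apply; last exact: ltr01.
move=> i xi; apply: sub_conv; exists i => //=.
by apply/negPn/negP => /xI xi0; rewrite xi0 ltxx in xi.
Qed.

Lemma gen_permutohedronP B x :
  @gen_permutohedron R d n B x <-> exists y, transport B x y.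
Proof.
split=> [[y yP ->]|[y [y0 yB yx y1]]].
  exists (\matrix_(i, k) y k 0 i); split.
  - by move=> i k; rewrite mxE; have [->] := (simplex_onP _ _).1 (yP k).
  - move=> i k Bik; rewrite mxE.
    by have [_ /(_ i Bik)] := (simplex_onP (fun i => B i k) _).1 (yP k).
  - by move=> i; under eq_bigr do rewrite mxE; rewrite summxE.
  - move=> k; under eq_bigr do rewrite mxE.
    by have [_ _ ->] := (simplex_onP _ _).1 (yP k).
exists (fun k => \row_i y i k).
  move=> k; apply/(simplex_onP (fun i => B i k)); split.
  - by move=> i; rewrite mxE.
  - by move=> i /yB; rewrite mxE.
  - by under eq_bigr do rewrite mxE.
apply/rowP => i; rewrite summxE -yx.
by apply: eq_bigr => k _; rewrite mxE.
Qed.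

End Permutohedron.

(** * Forgetting the last coordinate *)
Section Projection.
Variables (R : realType) (d n : nat).
Implicit Types (B : bigraph d.+1 n) (x : 'rV[R]_d.+1).

Definition proj x : d.-tuple R :=
  [tuple x 0 (widen_ord (leq_pred d.+1) i) | i < d].

(** Inverse of [proj] on the hyperplane [sum_i x_i = n]. *)
Definition unproj (z : d.-tuple R) : 'rV[R]_d.+1 :=
  \row_i if unlift ord_max i is Some j then tnth z j
         else n%:R - \sum_j tnth z j.

Lemma tnth_proj x i : tnth (proj x) i = x 0 (lift ord_max i).
Proof.
rewrite tnth_mktuple; congr (x 0 _).
by apply/val_inj; rewrite /= /bump leqNgt ltn_ord.
Qed.

Lemma sum_ord_max (F : 'I_d.+1 -> R) :
  \sum_i F i = F ord_max + \sum_(i < d) F (lift ord_max i).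
Proof. by rewrite (bigD1_ord ord_max). Qed.

Lemma unproj_max z : unproj z 0 ord_max = n%:R - \sum_j tnth z j.
Proof. by rewrite mxE unlift_none. Qed.

Lemma unproj_lift z j : unproj z 0 (lift ord_max j) = tnth z j.
Proof. by rewrite mxE liftK. Qed.

Lemma projK x : \sum_i x 0 i = n%:R -> unproj (proj x) = x.
Proof.
move=> xn; apply/rowP => i; rewrite mxE.
have [j|] := unliftP ord_max i => ->; first by rewrite tnth_proj.
under eq_bigr do rewrite tnth_proj.
by rewrite -xn sum_ord_max addrK.
Qed.

Lemma unprojK z : proj (unproj z) = z.
Proof. by apply: eq_from_tnth => i; rewrite tnth_proj mxE liftK. Qed.

Lemma measurable_unproj i : measurable_fun setT (fun z => unproj z 0 i).
Proof.
under eq_fun do rewrite mxE.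
case: unliftP => [j|] _; first exact: measurable_tnth.
apply: measurable_funB => //; apply: measurable_sum => j.
exact: measurable_tnth.
Qed.

Definition permutohedron_proj B : set (d.-tuple R) :=
  proj @` (@gen_permutohedron R d.+1 n B).

Lemma permutohedron_projP B z :
  permutohedron_proj B z <-> exists y, transport B (unproj z) y.
Proof.
split=> [[x /gen_permutohedronP[y xy] <-]|[y zy]].
  by exists y; rewrite projK//; exact: transport_total xy.
exists (unproj z); last exact: unprojK.
by apply/gen_permutohedronP; exists y.
Qed.

(** By elimination (with zero costs) the set is a finite intersection of
    half-spaces. *)
Lemma measurable_permutohedron_proj B : measurable (permutohedron_proj B).
Proof.
have [W [W1 W2]] := transport_elimination B (0 : 'M[R]_(d.+1, n)).
pose halfspace (w : R * 'rV[R]_d.+1 * 'rV[R]_n) : set (d.-tuple R) :=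
  [set z | 0 <= \sum_i w.1.2 0 i * unproj z 0 i + \sum_k w.2 0 k].
have mh w : measurable (halfspace w).
  apply: measurable_le_set => //; apply: measurable_funD => //.
  apply: measurable_sum => i; apply: measurable_funM => //.
  exact: measurable_unproj.
suff -> : permutohedron_proj B =
    [set z | forall i : 'I_(size W), halfspace (nth (0, 0, 0) W i) z].
  by apply: measurable_forall => i; exact: mh.
apply/seteqP; split => z.
  move=> /permutohedron_projP[y zy] i.
  set w := nth _ _ _; have [_ w0] := W1 w (mem_nth _ (ltn_ord i)).
  rewrite /halfspace /= -(transport_pairing _ _ zy).
  have [y0 yB _ _] := zy.
  apply: sumr_ge0 => j _; apply: sumr_ge0 => k _.
  have [Bjk|Bjk] := boolP (B j k); last by rewrite yB// mul0r.
  by rewrite mulr_ge0//; have := w0 j k Bjk; rewrite mxE mulr0 addr0.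
move=> zW; apply/permutohedron_projP.
have [|y zy _] := W2 (unproj z) 0; last by exists y.
move=> w wW; rewrite mulr0 add0r.
have i_lt : (index w W < size W)%N by rewrite index_mem.
by have := zW (Ordinal i_lt); rewrite /halfspace/= nth_index.
Qed.

(** Substituting [n] minus the other coordinates for the last one turns [q] into
    the coefficients [q_i - q_last], which do not all vanish as soon as [q] is
    not constant. *)
Lemma unproj_hyperplane_null (q : 'rV[R]_d.+1) c :
  (exists i j, q 0 i != q 0 j) ->
  exists2 N : set (d.-tuple R), measurable N & lebesgue_tuple N = 0%E /\
    [set z | \sum_i q 0 i * unproj z 0 i = c] `<=` N.
Proof.
move=> [i [j qij]].
have [l ql] : exists l : 'I_d, q 0 (lift ord_max l) - q 0 ord_max != 0.
  apply/not_existsP => ql; have qE k : q 0 k = q 0 ord_max.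
    have [l ->|->//] := unliftP ord_max k.
    by apply/eqP; rewrite -subr_eq0; apply/negPn/negP; exact: ql.
  by rewrite !qE eqxx in qij.
exists [set z : d.-tuple R |
    \sum_i (q 0 (lift ord_max i) - q 0 ord_max) * tnth z i
    = c - q 0 ord_max * n%:R].
  exact: measurable_hyperplane.
split.
  exact: (@lebesgue_tuple_hyperplane R d
    (fun i => q 0 (lift ord_max i) - q 0 ord_max) _ l).
move=> z /= <-.
rewrite sum_ord_max unproj_max.
have -> : \sum_i q 0 (lift ord_max i) * unproj z 0 (lift ord_max i) =
    \sum_i q 0 (lift ord_max i) * tnth z i.
  by apply: eq_bigr => k _; rewrite unproj_lift.
under eq_bigr do rewrite mulrBl.
rewrite sumrB -mulr_sumr; ring.
Qed.

End Projection.

(** * Fine types as supports of optimal plans *)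
Section FineTypes.
Variables (R : realType) (d n : nat) (A : 'M[\bar R]_(d, n)).
Hypothesis hA : tropical_matrix A.
Implicit Types (p x : 'rV[R]_d) (q : 'rV[R]_n) (y : 'M[R]_(d, n)).

Local Notation a := (\matrix_(i, k) fine (A i k) : 'M[R]_(d, n)).
Local Notation B := (support_graph A).

Lemma support_graphE i k : B i k = (A i k \is a fin_num).
Proof. by rewrite /support_graph mxE. Qed.

Lemma support_entry i k : B i k -> A i k = (a i k)%:E.
Proof. by rewrite support_graphE [(a i k)]mxE => /fineK. Qed.

Lemma fine_typeP p i k : fine_type A p i k <->
  B i k /\ forall j, B j k -> p 0 j - a j k <= p 0 i - a i k.
Proof.
rewrite /fine_type mxE support_graphE; split.
  move=> /andP[Aik /asboolP pik]; split=> // j Bjk.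
  have := pik j; rewrite (support_entry Bjk) (@support_entry i k);
    last by rewrite support_graphE.
  by rewrite -!EFinB lee_fin.
move=> [Aik h]; rewrite Aik; apply/asboolP => j.
have [Bjk|] := boolP (B j k).
  rewrite (support_entry Bjk) (@support_entry i k); last by rewrite support_graphE.
  by rewrite -!EFinB lee_fin; exact: h.
rewrite support_graphE; have [/(_ j k) + _] := hA.
by case: (A j k) => //= _ _; rewrite leNye.
Qed.

Lemma fine_type_sub p i k : fine_type A p i k -> B i k.
Proof. by move=> /fine_typeP[]. Qed.

(** [q k] is the maximum of [p_i - a_ik] over the finite entries of column [k];
    with it the fine type becomes the graph of tight edges. *)
Lemma column_potential p : exists q,
  (forall i k, B i k -> p 0 i - a i k <= q 0 k) /\
  (forall i k, fine_type A p i k <-> B i k /\ p 0 i - a i k = q 0 k).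
Proof.
have H k : exists r, (forall i, B i k -> p 0 i - a i k <= r) /\
    (forall i, fine_type A p i k <-> B i k /\ p 0 i - a i k = r).
  have [_ /(_ k)[i0 Ai0]] := hA.
  have Bi0 : B i0 k by rewrite support_graphE.
  case: (@arg_maxP _ _ _ i0 (fun i => B i k) (fun i => p 0 i - a i k) Bi0).
  move=> i Bik imax; exists (p 0 i - a i k); split; first exact: imax.
  move=> j; split=> [/fine_typeP[Bjk h]|[Bjk h]].
    by split=> //; apply/le_anti/andP; split; [exact: imax|exact: h].
  by apply/fine_typeP; split=> // l Bl; rewrite h; exact: imax.
have [f fP] := choice H.
have rE k : (\row_k f k) 0 k = f k by rewrite mxE.
exists (\row_k f k); split=> i k; rewrite rE; have [fP1 fP2] := fP k.
  exact: fP1.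
exact: fP2.
Qed.

Lemma fine_type_right_nbr p k : exists i, fine_type A p i k.
Proof.
have [_ /(_ k)[i0 Ai0]] := hA.
have Bi0 : B i0 k by rewrite support_graphE.
case: (@arg_maxP _ _ _ i0 (fun i => B i k) (fun i => p 0 i - a i k) Bi0).
by move=> i Bik imax; exists i; apply/fine_typeP.
Qed.

(** Complementary slackness: the edges carrying an optimal plan are tight for
    the dual potentials, hence belong to a fine type. *)
Lemma transport_cover x y : transport B x y ->
  exists p y', transport (fine_type A p) x y'.
Proof.
move=> /(transport_duality a)[y' [p [q [[y0 yB yx y1] pos eq0]]]].
exists (- p), y'; split=> // i k; apply: contraNeq => yik.
have {yik} yik : 0 < y' i k by rewrite lt_neqAle eq_sym yik y0.
have Bik : B i k by apply/negPn/negP => /yB yik0; rewrite yik0 ltxx in yik.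
apply/fine_typeP; split=> // j Bjk.
rewrite ![(- p) _ _]mxE.
have := eq0 i k yik; have := pos j k Bjk; lra.
Qed.

(** A plan supported on the fine type of [p] costs [p.x] minus the sum of the
    column maxima of [p], and no plan costs less.  Two such plans of the same
    [x], for [p] and for [p'], therefore have equal costs; [c] is the difference
    of the two sums of column maxima. *)
Lemma fine_type_overlap p p' :
  exists c, forall x y y', transport (fine_type A p) x y ->
    transport (fine_type A p') x y' -> \sum_i (p - p') 0 i * x 0 i = c.
Proof.
have [q [qB qT]] := column_potential p.
have [q' [q'B q'T]] := column_potential p'.
have costE (r : 'rV[R]_d) (s : 'rV[R]_n) x y :
    (forall i k, fine_type A r i k <-> B i k /\ r 0 i - a i k = s 0 k) ->
    transport (fine_type A r) x y ->
    \sum_i \sum_k y i k * a i k = \sum_i r 0 i * x 0 i - \sum_k s 0 k.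
  move=> rT tr; have [_ yT _ _] := tr.
  have := transport_pairing r (- s) tr.
  rewrite (_ : \sum_k (- s) 0 k = - \sum_k s 0 k) => [<-|]; last first.
    by rewrite -sumrN; apply: eq_bigr => k _; rewrite mxE.
  apply: eq_bigr => i _; apply: eq_bigr => k _.
  have [/rT[_ E]|/yT ->] := boolP (fine_type A r i k);
    last by rewrite !mul0r.
  by rewrite [(- s) _ _]mxE -E; congr (_ * _); lra.
have costG (r : 'rV[R]_d) (s : 'rV[R]_n) x y t :
    (forall i k, B i k -> r 0 i - a i k <= s 0 k) ->
    transport (fine_type A t) x y ->
    \sum_i r 0 i * x 0 i - \sum_k s 0 k <= \sum_i \sum_k y i k * a i k.
  move=> rB tr; have [y0 yT _ _] := tr.
  have := transport_pairing r (- s) tr.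
  rewrite (_ : \sum_k (- s) 0 k = - \sum_k s 0 k) => [<-|]; last first.
    by rewrite -sumrN; apply: eq_bigr => k _; rewrite mxE.
  apply: ler_sum => i _; apply: ler_sum => k _.
  have [/fine_type_sub/rB E|/yT ->] := boolP (fine_type A t i k);
    last by rewrite !mul0r.
  by apply: ler_wpM2l => //; rewrite [(- s) _ _]mxE; lra.
exists (\sum_k q 0 k - \sum_k q' 0 k) => x y y' tr tr'.
have h1 := costG _ _ _ _ _ qB tr'.
have h2 := costG _ _ _ _ _ q'B tr.
rewrite (costE _ _ _ _ q'T tr') in h1.
rewrite (costE _ _ _ _ qT tr) in h2.
under eq_bigr do rewrite !mxE mulrBl.
rewrite sumrB; lra.
Qed.

End FineTypes.

(** * Genericity makes fine types forests *)
Section RootPolytope.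
Variables (R : realType) (d n : nat).
Implicit Types (e f : 'I_d * 'I_n) (x : 'rV[R]_(d + n)).
Local Notation rp := (@root_point R d n).

Lemma dotprodE m (c x : 'rV[R]_m) : dotprod c x = \sum_j c 0 j * x 0 j.
Proof. by rewrite /dotprod mxE; apply: eq_bigr => j _; rewrite mxE. Qed.

Lemma dotprod_comb m (c x y : 'rV[R]_m) (s t : R) :
  dotprod c (s *: x + t *: y) = s * dotprod c x + t * dotprod c y.
Proof.
rewrite !dotprodE !mulr_sumr -big_split; apply: eq_bigr => j _ /=.
by rewrite !mxE; ring.
Qed.

Lemma dotprod_row m1 m2 (c1 x1 : 'rV[R]_m1) (c2 x2 : 'rV[R]_m2) :
  dotprod (row_mx c1 c2) (row_mx x1 x2) = dotprod c1 x1 + dotprod c2 x2.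
Proof. by rewrite /dotprod tr_row_mx mul_row_col mxE. Qed.

Lemma root_point_lshift e i : rp e 0 (lshift n i) = (i == e.1)%:R.
Proof. by rewrite !mxE eqxx /= (inj_eq (@lshift_inj _ _)) eq_lrshift subr0. Qed.

Lemma root_point_rshift e k : rp e 0 (rshift d k) = - (k == e.2)%:R.
Proof. by rewrite !mxE eqxx /= (inj_eq (@rshift_inj _ _)) eq_rlshift sub0r. Qed.

Lemma dotprod_root (c : 'rV[R]_(d + n)) e :
  dotprod c (rp e) = c 0 (lshift n e.1) - c 0 (rshift d e.2).
Proof.
rewrite dotprodE big_split_ord/= (bigD1 e.1)//= [X in _ + X](bigD1 e.2)//=.
rewrite root_point_lshift root_point_rshift !eqxx mulr1 mulrN1.
rewrite !big1 ?addr0// => i /negPf ie.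
  by rewrite root_point_rshift ie oppr0 mulr0.
by rewrite root_point_lshift ie mulr0.
Qed.

Lemma dotprod_roots e f :
  dotprod (rp e) (rp f) = ((f.1 == e.1) + (f.2 == e.2))%N%:R.
Proof.
by rewrite dotprod_root root_point_lshift root_point_rshift opprK natrD.
Qed.

(** On the roots the functional [<root e, .>] is at most 2, with equality at
    [root e] only; this convex set records that property of the vertex [root e]
    for sets of points that need not be hulls of roots. *)
Definition exposed e : set 'rV[R]_(d + n) :=
  [set x | dotprod (rp e) x <= 2 /\ (dotprod (rp e) x = 2 -> x = rp e)].

Lemma convex_exposed e x y (t : R) : 0 < t -> t < 1 ->
  exposed e x -> exposed e y -> exposed e (t *: x + (1 - t) *: y).
Proof.
move=> t0 t1 [x2 xE] [y2 yE].
split; first by rewrite dotprod_comb; nra.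
rewrite dotprod_comb => h.
have ex : dotprod (rp e) x = 2 by nra.
have ey : dotprod (rp e) y = 2 by nra.
by rewrite (xE ex) (yE ey) -scalerDl addrC subrK scale1r.
Qed.

Lemma root_point_exposed e f : exposed e (rp f).
Proof.
rewrite /exposed /= dotprod_roots; split.
  by rewrite ler_nat; case: (_ == _); case: (_ == _).
move=> /eqP; rewrite eqr_nat.
case: (f.1 =P e.1) => [f1|_]; case: (f.2 =P e.2) => [f2|_] // _.
by congr (rp _); case: f e f1 f2 => [? ?] [? ?] /= -> ->.
Qed.

(** Each root of [T] is an exposed point of [C], hence one of the vertices of
    the simplex, which are affinely independent; and a matrix [z] with zero
    margins is an affine dependency between the roots. *)
Lemma simplex_roots_independent (C : set 'rV[R]_(d + n)) (T : bigraph d n) :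
  is_simplex C -> (forall e, T e.1 e.2 -> C (rp e) /\ C `<=` exposed e) ->
  forall z : 'M[R]_(d, n), (forall i k, ~~ T i k -> z i k = 0) ->
  (forall i, \sum_k z i k = 0) -> (forall k, \sum_i z i k = 0) -> z = 0.
Proof.
move=> [m [v [vind CE]]] TC z zT zr zc.
have vertex e : T e.1 e.2 -> exists j, v j = rp e.
  move=> Te; have [Ce Cexp] := TC e Te.
  apply/not_existsP => vne.
  have Ce' : (Defs.conv (range v)) (rp e) by rewrite -CE.
  have H : @convex_set R 'rV[R]_(d + n) [set x | dotprod (rp e) x < 2].
    by apply: convex_setP => x y t t0 t1 /= x2 y2; rewrite dotprod_comb; nra.
  have vH : range v `<=` [set x | dotprod (rp e) x < 2].
    move=> _ [j _ <-] /=.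
    have [v2 vE] : exposed e (v j).
      by apply: Cexp; rewrite CE; apply: sub_conv; exists j.
    by rewrite lt_neqAle v2 andbT; apply/eqP => /vE; exact: vne.
  by have := conv_sub H vH Ce'; rewrite /= dotprod_roots !eqxx ltxx.
have [e0 Te0|noT] := pickP (fun e => T e.1 e.2); last first.
  by apply/matrixP => i k; rewrite mxE zT//; have /= -> := noT (i, k).
have [j0 _] := vertex e0 Te0.
have vertex' e : exists j, T e.1 e.2 -> v j = rp e.
  by have [/vertex[j vj]|_] := boolP (T e.1 e.2); [exists j|exists j0].
have [g gP] := choice vertex'.
pose w j := \sum_(e | T e.1 e.2 && (g e == j)) z e.1 e.2.
have partition (V : lmodType R) (f : 'I_m -> V) :
    \sum_j w j *: f j = \sum_e z e.1 e.2 *: f (g e).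
  under eq_bigr do rewrite scaler_suml.
  rewrite (exchange_big_dep (fun e => T e.1 e.2))/=; last by move=> j e _ /andP[].
  rewrite [RHS](bigID (fun e => T e.1 e.2))/=.
  rewrite [X in _ = _ + X]big1 ?addr0; last first.
    by move=> e /zT ->; rewrite scale0r.
  apply: eq_bigr => e Te; rewrite (big_pred1 (g e))// => j.
  by rewrite Te eq_sym.
have w0 : forall j, w j = 0.
  apply: vind.
    have := partition R^o (fun=> 1); rewrite /GRing.scale/=.
    under eq_bigr do rewrite mulr1.
    under [RHS]eq_bigr do rewrite mulr1.
    move=> ->; rewrite -(pair_bigA _ (fun i k => z i k))/=.
    by rewrite big1.
  rewrite partition; transitivity (\sum_e z e.1 e.2 *: rp e).
    apply: eq_bigr => e _; have [/gP -> //|/zT ->] := boolP (T e.1 e.2).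
    by rewrite !scale0r.
  apply/rowP => l; rewrite summxE [RHS]mxE.
  under eq_bigr do rewrite mxE.
  rewrite -(pair_bigA _ (fun i k => z i k * rp (i, k) 0 l))/=.
  case: (split_ordP l) => [i ->|k ->].
    rewrite (bigD1 i)//= [X in _ + X]big1 ?addr0.
      under eq_bigr do rewrite root_point_lshift eqxx mulr1.
      exact: zr.
    move=> i' /negPf i'i; rewrite big1// => k _.
    by rewrite root_point_lshift eq_sym i'i mulr0.
  rewrite exchange_big/= (bigD1 k)//= [X in _ + X]big1 ?addr0.
    under eq_bigr do rewrite root_point_rshift eqxx mulrN1.
    by rewrite sumrN zc oppr0.
  move=> k' /negPf k'k; rewrite big1// => i _.
  by rewrite root_point_rshift eq_sym k'k oppr0 mulr0.
apply/matrixP => i k; rewrite mxE.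
have [Tik|/zT//] := boolP (T i k).
have := w0 (g (i, k)); rewrite /w (big_pred1 (i, k))// => -[i' k'] /=.
apply/andP/eqP => [[Te /eqP ge]|[-> ->]]; last by rewrite Tik eqxx.
have : rp (i', k') = rp (i, k) by rewrite -!gP// ge.
move=> rE.
have ei : i = i'.
  have := root_point_lshift (i', k') i; rewrite rE root_point_lshift eqxx/=.
  by case: eqP => // _ /eqP; rewrite oner_eq0.
have ek : k = k'.
  have := root_point_rshift (i', k') k; rewrite rE root_point_rshift eqxx/=.
  by case: eqP => // _ /eqP; rewrite oppr0 oppr_eq0 oner_eq0.
by rewrite ei ek.
Qed.

End RootPolytope.

(** The functional [c] has value [a_ik - p_i + q_k >= 0] at the lifted edge
    [(i, k)], with equality on the fine type of [p]: so the lower face of [c]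
    contains the lifted edges of the fine type, and its projection is a simplex
    by genericity. *)
Lemma fine_type_acyclic (R : realType) (d n : nat) (A : 'M[\bar R]_(d, n))
    (p : 'rV[R]_d) (z : 'M[R]_(d, n)) :
  tropical_matrix A -> sufficiently_generic A ->
  (forall i k, ~~ fine_type A p i k -> z i k = 0) ->
  (forall i, \sum_k z i k = 0) -> (forall k, \sum_i z i k = 0) -> z = 0.
Proof.
move=> hA hgen zT zr zc.
have [q [qB qT]] := column_potential hA p.
pose h e := fine (A e.1 e.2).
pose lifted e := row_mx (@root_point R d n e) (h e)%:M : 'rV[R]_(d + n + 1).
pose L := Defs.conv [set lifted e | e in edges (support_graph A)].
pose c : 'rV[R]_(d + n + 1) := row_mx (row_mx (- p) (- q)) 1%:M.
have dot_c e : dotprod c (lifted e) = - p 0 e.1 + q 0 e.2 + h e.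
  rewrite dotprod_row dotprod_root row_mxEl row_mxEr !mxE opprK; congr (_ + _).
  by rewrite dotprodE big_ord1 !mxE eqxx !mulr1n mul1r.
pose C := lsubmx @` face c L.
have simpC : is_simplex C.
  apply: hgen; exists (face c L) => //; exists c => //.
  by rewrite row_mxEr mxE ltr01.
have c_ge0 y : L y -> 0 <= dotprod c y.
  have H : @convex_set R 'rV[R]_(d + n + 1) [set y | 0 <= dotprod c y].
    by apply: convex_setP => x x' t t0 t1 /= x2 y2; rewrite dotprod_comb; nra.
  move=> /(conv_sub H); apply => _ [e Be <-] /=.
  have := qB e.1 e.2 Be; rewrite dot_c !mxE -/(h e); lra.
apply: (simplex_roots_independent simpC _ zT zr zc) => e Te; split.
  exists (lifted e); last by rewrite row_mxKl.
  split; first by apply: sub_conv; exists e => //; exact: (fine_type_sub hA Te).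
  move=> y /c_ge0; apply: le_trans.
  have [_] := (qT e.1 e.2).1 Te; rewrite dot_c !mxE -/(h e); lra.
move=> _ [y [Ly _] <-].
have H : @convex_set R 'rV[R]_(d + n + 1) [set y | exposed e (lsubmx y)].
  apply: convex_setP => x x' t t0 t1 /= xe x'e.
  rewrite linearD !linearZ /=; exact: convex_exposed.
apply: (conv_sub H _ Ly) => _ [f _ <-] /=.
by rewrite row_mxKl; exact: root_point_exposed.
Qed.

(** * The cell of a rooted tree *)
Section RootedTree.
Variables (R : realType) (d n : nat) (T : bigraph d.+1 n).
Variables (rank : 'I_d.+1 -> nat) (kap : 'I_d -> 'I_n) (top : 'I_n -> 'I_d.+1).
Local Notation l := (lift ord_max : 'I_d -> 'I_d.+1).

(** The tree is rooted at the last left node.  Each other left node [l j] is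
    joined to its parent [kap j], and each right node [k] to its parent [top k];
    these are all the edges. *)
Definition child_edge (i : 'I_d.+1) (k : 'I_n) : bool :=
  if unlift ord_max i is Some j then kap j == k else false.

Hypothesis rank_parent : forall j, (rank (top (kap j)) < rank (l j))%N.
Hypothesis T_edges : forall i k, T i k = (i == top k) || child_edge i k.

Lemma child_edge_lift j k : child_edge (l j) k = (kap j == k).
Proof. by rewrite /child_edge liftK. Qed.

Lemma child_edge_max k : child_edge ord_max k = false.
Proof. by rewrite /child_edge unlift_none. Qed.

Lemma child_edge_neq i k : child_edge i k -> i != top k.
Proof.
have [j ->|->] := unliftP ord_max i; last by rewrite child_edge_max.
rewrite child_edge_lift => /eqP <-; apply/eqP => E.
by have := rank_parent j; rewrite -E ltnn.
Qed.

Lemma T_edgesE i k : (T i k = (i == top k) + child_edge i k :> nat)%N.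
Proof.
rewrite T_edges; have [/child_edge_neq/negPf ->//|_] := boolP (child_edge i k).
by rewrite orbF addn0.
Qed.

Lemma right_degree_tree k : right_degree T k = (block_size kap k).+1.
Proof.
rewrite /right_degree; under eq_bigr do rewrite T_edgesE.
rewrite big_split/= (bigD1 (top k))//= eqxx big1 => [|i /negPf ->//].
rewrite (bigD1_ord ord_max)//= child_edge_max add0n addn0 add1n.
by congr S; apply: eq_bigr => j _; rewrite child_edge_lift.
Qed.

Lemma sum_tree_col (f : 'I_d.+1 -> 'I_n -> R) k :
  \sum_i (T i k)%:R * f i k =
  f (top k) k + \sum_(j | kap j == k) f (l j) k.
Proof.
under eq_bigr do rewrite T_edgesE natrD mulrDl.
rewrite big_split/=; congr (_ + _).
  rewrite (bigD1 (top k))//= eqxx mul1r big1 ?addr0// => i /negPf ->.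
  by rewrite mul0r.
rewrite sum_ord_max child_edge_max mul0r add0r [RHS]big_mkcond.
apply: eq_bigr => j _; rewrite child_edge_lift.
by case: ifP; rewrite ?mul1r ?mul0r.
Qed.

Lemma sum_tree_row (f : 'I_d.+1 -> 'I_n -> R) j :
  \sum_k (T (l j) k)%:R * f (l j) k =
  f (l j) (kap j) + \sum_(k | top k == l j) f (top k) k.
Proof.
under eq_bigr do rewrite T_edgesE natrD mulrDl child_edge_lift.
rewrite big_split/= addrC; congr (_ + _).
  rewrite (bigD1 (kap j))//= eqxx mul1r big1 ?addr0// => k /negPf.
  by rewrite eq_sym => ->; rewrite mul0r.
rewrite [RHS]big_mkcond; apply: eq_bigr => k _.
by rewrite eq_sym; case: eqP => [->|]; rewrite ?mul1r ?mul0r.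
Qed.

(** Given the entries [y j] on the edges from [l j] to [kap j], the entry on the
    edge from [k] to [top k] is determined by the sum of column [k]. *)
Definition parent_flow (y : d.-tuple R) k : R :=
  1 - \sum_(j | kap j == k) tnth y j.

Definition row_shift (i : 'I_d) (y : d.-tuple R) : R :=
  \sum_(k | top k == l i) parent_flow y k.

Definition row_sums (y : d.-tuple R) : d.-tuple R :=
  [tuple tnth y i + row_shift i y | i < d].

Lemma permutohedron_proj_tree :
  @permutohedron_proj R d n T = row_sums @` corner_product kap (fun=> 1).
Proof.
apply/seteqP; split => z.
  move=> /permutohedron_projP[Y [Y0 YT Yr Yc]].
  have YE i k : Y i k = (T i k)%:R * Y i k.
    by have [_|/YT ->] := boolP (T i k); rewrite ?mul1r ?mulr0.
  pose y := [tuple Y (l j) (kap j) | j < d].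
  have colE k : Y (top k) k = parent_flow y k.
    rewrite /parent_flow -(Yc k); under [X in X - _]eq_bigr do rewrite YE.
    rewrite (sum_tree_col (fun i k => Y i k)).
    rewrite [X in _ + _ - X](eq_bigr (fun j => Y (l j) k)).
      by rewrite addrK.
    by move=> j /eqP <-; rewrite tnth_mktuple.
  exists y; first split.
  - by move=> i; rewrite tnth_mktuple.
  - by move=> k; have := Y0 (top k) k; rewrite colE /parent_flow subr_ge0.
  - apply: eq_from_tnth => j; rewrite !tnth_mktuple -(unproj_lift n z) -Yr.
    under [RHS]eq_bigr do rewrite YE.
    rewrite (sum_tree_row (fun i k => Y i k)); congr (_ + _).
    by apply: eq_bigr => k _; rewrite colE.
move=> [y [y0 y1] <-]; apply/permutohedron_projP.
pose g i k := if i == top k then parent_flow y k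
  else if unlift ord_max i is Some j then tnth y j else 0.
have gtop k : g (top k) k = parent_flow y k by rewrite /g eqxx.
have gl j : g (l j) (kap j) = tnth y j.
  rewrite /g liftK ifF//; apply/negbTE; apply: child_edge_neq.
  by rewrite child_edge_lift.
pose Y : 'M[R]_(d.+1, n) := \matrix_(i, k) ((T i k)%:R * g i k).
have Yc k : \sum_i Y i k = 1.
  under eq_bigr do rewrite mxE.
  rewrite sum_tree_col gtop /parent_flow.
  rewrite -[RHS](subrK (\sum_(j | kap j == k) tnth y j)).
  by congr (_ + _); apply: eq_bigr => j /eqP <-.
have Yr j : \sum_k Y (l j) k = tnth (row_sums y) j.
  under eq_bigr do rewrite mxE.
  by rewrite sum_tree_row gl tnth_mktuple; congr (_ + _); apply: eq_bigr => k _.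
exists Y; split.
- move=> i k; rewrite mxE mulr_ge0// /g; case: ifP => _.
    by rewrite /parent_flow subr_ge0.
  by case: unliftP => [j|] _.
- by move=> i k /negPf Tik; rewrite mxE Tik mul0r.
- move=> i; have [j ->|->] := unliftP ord_max i; first by rewrite unproj_lift.
  rewrite unproj_max.
  have : \sum_i \sum_k Y i k = n%:R.
    rewrite exchange_big/=; under eq_bigr do rewrite Yc.
    by rewrite sumr_const card_ord.
  rewrite sum_ord_max => <-.
  by under [X in _ = _ + X - _]eq_bigr do rewrite Yr; rewrite addrK.
- exact: Yc.
Qed.

(** [row_shift i y] involves [y j] only if [l i] is the grandparent of [l j], so
    the map [row_sums] is triangular for the rank. *)
Lemma volume_tree : lebesgue_tuple (@permutohedron_proj R d n T) =
  (\prod_k (((right_degree T k).-1)`!%:R)^-1)%:E.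
Proof.
rewrite permutohedron_proj_tree.
have [||_ ->] := @lebesgue_tuple_triangular R d (fun j => rank (l j)) row_shift
    (corner_product kap (fun=> 1)) _ _ (measurable_corner_product _ _).
- move=> i; apply: measurable_sum_cond => k.
  apply: measurable_funB => //; apply: measurable_sum_cond => j.
  exact: measurable_tnth.
- move=> i x y xy; apply: eq_bigr => k /eqP ik; congr (_ - _).
  by apply: eq_bigr => j /eqP jk; apply: xy; rewrite -ik -jk.
rewrite lebesgue_corner_product//; congr EFin; apply: eq_bigr => k _.
by rewrite expr1n mul1r right_degree_tree.
Qed.

End RootedTree.

(** * Acyclic connected graphs are rooted trees *)
Section SpanningTree.
Variables (R : realType) (d n : nat) (T : bigraph d.+1 n).

Hypothesis acyclic : forall z : 'M[R]_(d.+1, n),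
  (forall i k, ~~ T i k -> z i k = 0) -> (forall i, \sum_k z i k = 0) ->
  (forall k, \sum_i z i k = 0) -> z = 0.
Hypothesis right_nbr : forall k, exists i, T i k.
Hypothesis connected : forall S : {set 'I_d.+1}, ord_max \in S ->
  (forall i i' k, i \in S -> T i k -> T i' k -> i' \in S) -> S = [set: _]%SET.

Local Notation l := (lift ord_max : 'I_d -> 'I_d.+1).

(** Breadth-first search from the last left node; the order of appearance
    [fix_order grow] is the rank used to root the tree. *)
Definition grow (S : {set 'I_d.+1}) : {set 'I_d.+1} :=
  (ord_max |:
   finset (fun i => [exists i' in S, [exists k, T i k && T i' k]]))%SET.

Lemma grow_mono : {homo grow : X Y / X \subset Y}.
Proof.
move=> X Y XY; apply: finset.setUS; apply/fintype.subsetP => i; rewrite !inE.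
move=> /existsP[i' /andP[i'X h]]; apply/existsP; exists i'.
by rewrite (fintype.subsetP XY).
Qed.

Lemma grow_full : fixset grow = [set: 'I_d.+1]%SET.
Proof.
apply: connected; first by rewrite -fixsetK ?inE ?eqxx//; exact: grow_mono.
move=> i i' k iS Tik Ti'k; rewrite -fixsetK; last exact: grow_mono.
rewrite !inE; apply/orP; right; apply/existsP; exists i; rewrite iS.
by apply/existsP; exists k; rewrite Ti'k.
Qed.

Local Notation rank := (fix_order grow).

Lemma rank_step (j : 'I_d) : exists k, T (l j) k /\
  exists2 i, T i k & (rank i < rank (l j))%N.
Proof.
have H : l j \in iter (rank (l j)) grow finset.set0.
  by rewrite in_iter_fix_orderE ?grow_full ?inE//; exact: grow_mono.
have r0 : (0 < rank (l j))%N.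
  by rewrite fix_order_gt0 ?grow_full ?inE//; exact: grow_mono.
move: H; rewrite -(prednK r0) iterS !inE.
rewrite eq_sym (negPf (neq_lift _ _))/= => /existsP[i /andP[iS]].
move=> /existsP[k /andP[Tjk Tik]].
exists k; split=> //; exists i => //.
by rewrite ltnS; apply: fix_order_small => //; exact: grow_mono.
Qed.

(** Choose as parents a right node [kap j] that leads closer to the root and a
    left node [top k] of least rank.  Sending a unit from any left node to the
    root along parent edges is a flow on these edges, so an additional edge of
    [T] would close up to a nonzero matrix with zero margins. *)
Lemma volume_spanning_tree : lebesgue_tuple (@permutohedron_proj R d n T) =
  (\prod_k (((right_degree T k).-1)`!%:R)^-1)%:E.
Proof.
have [kap kapP] := choice rank_step.
have top_ex k : exists i, T i k /\ forall i', T i' k -> (rank i <= rank i')%N.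
  have [i0 Ti0] := right_nbr k.
  by case: (@arg_minnP _ i0 (fun i => T i k) rank Ti0) => i Tik imin; exists i.
have [top topP] := choice top_ex.
have rank_parent j : (rank (top (kap j)) < rank (l j))%N.
  have [_ [i Tik]] := kapP j; apply: leq_ltn_trans.
  by have [_] := topP (kap j); apply.
pose tree i k := (i == top k) || child_edge kap i k.
have treeT i k : tree i k -> T i k.
  move=> /orP[/eqP ->|]; first by have [] := topP k.
  have [j ->|->] := unliftP ord_max i; last by rewrite child_edge_max.
  by rewrite child_edge_lift => /eqP <-; have [] := kapP j.
have entry (A A' A'' : 'M[R]_(d.+1, n)) i1 k1 :
    (A + A' - A'') i1 k1 = A i1 k1 + A' i1 k1 - A'' i1 k1.
  by rewrite !mxE.
have row_delta (i1 i2 : 'I_d.+1) (k2 : 'I_n) :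
    \sum_k (delta_mx i2 k2 : 'M[R]_(_, _)) i1 k = (i1 == i2)%:R.
  rewrite (bigD1 k2)//= mxE eqxx andbT big1 ?addr0// => k /negPf kk.
  by rewrite mxE kk andbF.
have col_delta (k1 : 'I_n) (i2 : 'I_d.+1) (k2 : 'I_n) :
    \sum_i (delta_mx i2 k2 : 'M[R]_(_, _)) i k1 = (k1 == k2)%:R.
  rewrite (bigD1 i2)//= mxE eqxx big1 ?addr0// => i1 /negPf kk.
  by rewrite mxE kk.
have entry2 (A A' A'' A3 : 'M[R]_(d.+1, n)) i1 k1 :
    (A - A' - A'' + A3) i1 k1 = A i1 k1 - A' i1 k1 - A'' i1 k1 + A3 i1 k1.
  by rewrite !mxE.
have flow i : exists f : 'M[R]_(d.+1, n), [/\
    forall i' k, ~~ tree i' k -> f i' k = 0,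
    forall i', \sum_k f i' k = (i' == i)%:R - (i' == ord_max)%:R &
    forall k, \sum_i' f i' k = 0].
  have [m] := ubnP (rank i); elim: m i => // m IH i; rewrite ltnS => im.
  have [j ij|->] := unliftP ord_max i; last first.
    by exists 0; split => [i' k _|i'|k]; rewrite ?mxE// ?subrr big1// => ? _;
      rewrite mxE.
  have [|f [fT fr fc]] := IH (top (kap j)).
    by apply: leq_trans im; rewrite ij; exact: rank_parent.
  exists (f + delta_mx i (kap j) - delta_mx (top (kap j)) (kap j)).
  split=> [i' k nt|i'|k].
  - rewrite !mxE fT// add0r.
    have -> : (i' == i) && (k == kap j) = false.
      apply/negP => /andP[/eqP ei /eqP ek]; move/negP: nt; apply.
      by rewrite ei ek ij /tree child_edge_lift eqxx orbT.
    have -> : (i' == top (kap j)) && (k == kap j) = false.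
      apply/negP => /andP[/eqP ei /eqP ek]; move/negP: nt; apply.
      by rewrite ei ek /tree eqxx.
    by rewrite subrr.
  - under eq_bigr do rewrite entry.
    by rewrite sumrB big_split/= fr !row_delta; ring.
  - under eq_bigr do rewrite entry.
    by rewrite sumrB big_split/= fc !col_delta add0r subrr.
have T_edges i k : T i k = tree i k.
  apply/idP/idP; last exact: treeT.
  move=> Tik; apply/negPn/negP => ntree.
  have [f [fT fr fc]] := flow i; have [g [gT gr gc]] := flow (top k).
  have ntop : i != top k by apply: contra ntree => /eqP ->; rewrite /tree eqxx.
  have tree_top : tree (top k) k by rewrite /tree eqxx.
  (* The circuit closed by the edge [(i, k)] and the paths to the root. *)
  have : f - g - delta_mx i k + delta_mx (top k) k = 0.
    apply: acyclic => [i' k' nT|i'|k'].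
    - have nt : ~~ tree i' k' by apply: contra nT; exact: treeT.
      rewrite !mxE fT// gT// subrr add0r.
      have -> : (i' == i) && (k' == k) = false.
        by apply/negP => /andP[/eqP ei /eqP ek]; rewrite ei ek Tik in nT.
      have -> : (i' == top k) && (k' == k) = false.
        by apply/negP => /andP[/eqP ei /eqP ek]; rewrite ei ek tree_top in nt.
      by rewrite oppr0 addr0.
    - under eq_bigr do rewrite entry2.
      by rewrite big_split/= !sumrB fr gr !row_delta; ring.
    - under eq_bigr do rewrite entry2.
      by rewrite big_split/= !sumrB fc gc !col_delta subrr sub0r addNr.
  move=> /matrixP/(_ i k); rewrite !mxE fT// gT// !eqxx (negPf ntop)/=.
  by move=> /eqP; rewrite subrr sub0r addr0 oppr_eq0 oner_eq0.
exact: (@volume_tree R d n T rank kap top rank_parent T_edges).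
Qed.

End SpanningTree.

(** * Almost disjoint unions *)
Section AlmostDisjoint.
Context d (X : measurableType d) (R : realType).
Variable mu : {measure set X -> \bar R}.

Lemma measureU_null (D E : set X) : measurable D -> measurable E ->
  mu (D `&` E) = 0%E -> mu (D `|` E) = (mu D + mu E)%E.
Proof.
move=> mD mE DE0.
have -> : D `|` E = D `|` (E `\` D).
  apply/seteqP; split=> x; last by case=> [Dx|[Ex _]]; [left|right].
  by case=> [Dx|Ex]; [left|have [Dx|nDx] := pselect (D x); [left|right]].
rewrite measureU//; [congr (_ + _)%E|exact: measurableD|]; last first.
  by apply/seteqP; split=> x // [Dx []].
have -> : mu E = (mu (E `\` D) + mu (E `&` D))%E by exact: measureDI.
by rewrite [E `&` D]setIC DE0 adde0.
Qed.

Lemma measure_setI_bigsetU_null (I : eqType) (s : seq I) (D : I -> set X)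
    (E : set X) :
  measurable E -> (forall i, measurable (D i)) ->
  (forall i, i \in s -> mu (E `&` D i) = 0%E) ->
  mu (E `&` \big[setU/set0]_(i <- s) D i) = 0%E.
Proof.
move=> mE mD; elim: s => [|i s IH] D0; first by rewrite big_nil setI0 measure0.
have mU : measurable (\big[setU/set0]_(j <- s) D j).
  by apply: bigsetU_measurable.
have mEi : measurable (E `&` D i) by exact: measurableI.
have mEU : measurable (E `&` \big[setU/set0]_(j <- s) D j).
  exact: measurableI.
have E0 : mu (E `&` D i) = 0%E by apply: D0; exact: mem_head.
rewrite big_cons setIUr measureU_null//.
  by rewrite E0 add0e IH// => j js; apply: D0; rewrite in_cons js orbT.
by apply: (subset_measure0 _ mEi) => //; exact: measurableI.
Qed.

Lemma measure_almost_disjoint (I : eqType) (s : seq I) (D : I -> set X) :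
  uniq s -> (forall i, measurable (D i)) ->
  {in s &, forall i j, i != j -> mu (D i `&` D j) = 0%E} ->
  mu (\big[setU/set0]_(i <- s) D i) = (\sum_(i <- s) mu (D i))%E.
Proof.
move=> + mD; elim: s => [|i s IH]; first by rewrite !big_nil measure0.
move=> /= /andP[nis us] D0; rewrite !big_cons measureU_null//.
- congr (_ + _)%E; apply: IH => // j k js ks.
  by apply: D0; rewrite in_cons ?js ?ks orbT.
- by apply: bigsetU_measurable.
- apply: measure_setI_bigsetU_null => // j js.
  apply: D0; rewrite ?mem_head ?in_cons ?js ?orbT//.
  by apply: contraNneq nis => ->.
Qed.

End AlmostDisjoint.

(** * Vertices of the tropical complex *)
Section Vertices.
Variables (R : realType) (d n : nat) (A : 'M[\bar R]_(d.+1, n)).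
Hypothesis hA : tropical_matrix A.
Implicit Types p : 'rV[R]_d.+1.

Lemma fine_type_translate p c :
  fine_type A (p + c *: const_mx 1) = fine_type A p.
Proof.
apply/matrixP => i k; apply/idP/idP => /(fine_typeP hA)[Bik h];
  apply/(fine_typeP hA); split=> // j /h; rewrite !mxE; lra.
Qed.

Lemma cellP (T : bigraph d.+1 n) p :
  cell A T p <-> forall i k, T i k -> fine_type A p i k.
Proof.
split=> h i k; last by have := h i k; case: (T i k) => // ->.
by move=> Tik; have := h i k; rewrite Tik lt0b.
Qed.

Lemma not_translate p p' : ~ (exists c, p' = p + c *: const_mx 1) ->
  exists i j, (p - p') 0 i != (p - p') 0 j.
Proof.
move=> np; apply/not_existsP => h; apply: np; exists (p' 0 ord0 - p 0 ord0).
apply/rowP => i; have [E|ne] := eqVneq ((p - p') 0 i) ((p - p') 0 ord0).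
  by move: E; rewrite !mxE; lra.
by case: (h i); exists ord0.
Qed.

Lemma vertex_type_rigid T p : T \in vertex_types A -> T = fine_type A p ->
  forall p', cell A T p' -> exists c, p' = p + c *: const_mx 1.
Proof.
rewrite inE => /asboolP[_ [_ [p0 cE]]] TE p' cp'.
have : cell A T p by apply/cellP => i k; rewrite TE.
rewrite cE => -[_ -> [c pE]].
move: cp'; rewrite cE => -[_ -> [c' p'E]].
exists (c' - c); rewrite pE p'E -addrA -scalerDl.
by congr (_ + _ *: _); lra.
Qed.

(** Otherwise the cell would reduce to the class of [p], which is a bounded
    point. *)
Lemma nonvertex_type_flexible p : fine_type A p \notin vertex_types A ->
  exists2 p', cell A (fine_type A p) p' &
    ~ exists c, p' = p + c *: const_mx 1.
Proof.
move=> nv; apply: contrapT => h; move/negP: nv; apply.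
rewrite inE; apply/asboolP; split; first by exists p.
have cE : cell A (fine_type A p) = saturation [set p].
  apply/seteqP; split=> [p' cp'|_ [_ -> [c ->]]].
    exists p => //; apply: contrapT => np'.
    by apply: h; exists p'.
  by apply/cellP => i k; rewrite fine_type_translate.
split; last by exists p.
split; first by exists (fine_type A p) => //; exists p.
exists [set p]; last by rewrite cE.
by exists `|p|; split; [exact: num_real|move=> M pM _ ->; exact: ltW].
Qed.

Lemma small_positive (I : finType) (g : I -> R) : (forall i, 0 < g i) ->
  exists2 e, 0 < e & forall i, e <= g i.
Proof.
move=> g0; exists (\big[Order.min/1]_i g i).
  rewrite ltNge; apply/negP => /bigmin_leP[|[i _]]; first by rewrite leNgt ltr01.
  by rewrite leNgt g0.
by move=> i; apply: bigmin_le.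
Qed.

(** If [S] is a union of components avoiding some left node, raising [p] by a
    small amount on [S] keeps all edges of the fine type tight, and moves [p]
    within the cell to a point that is not a translate of it. *)
Lemma vertex_type_connected p (S : {set 'I_d.+1}) :
  fine_type A p \in vertex_types A -> ord_max \in S ->
  (forall i i' k, i \in S -> fine_type A p i k -> fine_type A p i' k ->
     i' \in S) ->
  S = [set: _]%SET.
Proof.
move=> vT maxS closed; apply/setP => i0; rewrite inE; apply/negPn/negP => i0S.
have [q [qB qT]] := column_potential hA p.
pose a i k := fine (A i k).
(* [e] is at most the slack of every edge of the support that is not tight. *)
have [|e e0 eg] := @small_positive ('I_d.+1 * 'I_n)%type (fun f =>
  if support_graph A f.1 f.2 && ~~ fine_type A p f.1 f.2
  then q 0 f.2 - (p 0 f.1 - a f.1 f.2) else 1).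
  move=> [i k] /=; case: ifP => [/andP[Bik nT]|_]; last exact: ltr01.
  rewrite subr_gt0 lt_neqAle; apply/andP; split; last first.
    by have := qB i k Bik; rewrite mxE.
  apply: contra nT => /eqP E; apply/qT; split=> //.
  by rewrite mxE.
pose p' : 'rV[R]_d.+1 := \row_i (p 0 i + if i \in S then e else 0).
have cp' : cell A (fine_type A p) p'.
  apply/cellP => i k Tik; have [Bik] := (qT i k).1 Tik; rewrite mxE => qik.
  apply/(fine_typeP hA); split=> // j Bjk; rewrite !mxE.
  have := qB j k Bjk; rewrite mxE.
  have [iS|iS] := boolP (i \in S); first by case: (j \in S); lra.
  have [jS|jS] := boolP (j \in S); last by lra.
  have njT : ~~ fine_type A p j k.
    by apply: contra iS => Tjk; exact: closed jS Tjk Tik.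
  by have := eg (j, k); rewrite /= Bjk njT /a /=; lra.
have [c p'E] := vertex_type_rigid vT erefl cp'.
have := congr1 (fun x : 'rV_d.+1 => x 0 ord_max) p'E.
have := congr1 (fun x : 'rV_d.+1 => x 0 i0) p'E.
by rewrite !mxE maxS (negPf i0S); lra.
Qed.

End Vertices.

(** * The subdivision and the volume formula *)
Section MixedSubdivision.
Variables (R : realType) (d n : nat) (A : 'M[\bar R]_(d.+1, n)).
Hypothesis hA : tropical_matrix A.
Implicit Types (p : 'rV[R]_d.+1) (T : bigraph d.+1 n).

Local Notation D := (@permutohedron_proj R d n).

Lemma mixed_cells_overlap_null p p' (T T' : bigraph d.+1 n) :
  (forall i k, T i k -> fine_type A p i k) ->
  (forall i k, T' i k -> fine_type A p' i k) ->
  ~ (exists c, p' = p + c *: const_mx 1) ->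
  lebesgue_tuple (D T `&` D T') = 0%E.
Proof.
move=> Tp T'p' /not_translate npp'.
have [c cP] := fine_type_overlap hA p p'.
have [N mN [N0 sub]] := @unproj_hyperplane_null R d n (p - p') c npp'.
apply: (@subset_measure0 _ _ _ (@lebesgue_tuple R d) _ N) => //.
  by apply: measurableI; exact: measurable_permutohedron_proj.
move=> z [/permutohedron_projP[y zy] /permutohedron_projP[y' zy']].
by apply: sub; apply: (cP _ y y');
  [exact: transport_mono Tp zy|exact: transport_mono T'p' zy'].
Qed.

Lemma vertex_cell_volume T : sufficiently_generic A -> T \in vertex_types A ->
  lebesgue_tuple (D T) = (\prod_k (((right_degree T k).-1)`!%:R)^-1)%:E.
Proof.
move=> hgen TV; move: (TV); rewrite inE => /asboolP[[p _ pT] _]; subst T.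
apply: volume_spanning_tree.
- by move=> z; exact: fine_type_acyclic.
- by move=> k; exact: fine_type_right_nbr.
- by move=> S; exact: vertex_type_connected.
Qed.

Lemma nonvertex_cell_null p : fine_type A p \notin vertex_types A ->
  lebesgue_tuple (D (fine_type A p)) = 0%E.
Proof.
move=> /(nonvertex_type_flexible hA)[p' /cellP cp' npp'].
by rewrite -[D _]setIid; exact: (mixed_cells_overlap_null (p := p) (p' := p')).
Qed.

Definition fine_types : {set bigraph d.+1 n} :=
  finset (fun T => `[< range (fine_type A) T >]).

Lemma fine_typesP T : T \in fine_types -> exists p, T = fine_type A p.
Proof. by rewrite inE => /asboolP[p _ <-]; exists p. Qed.

Lemma mixed_cells_cover :
  D (support_graph A) = \big[setU/set0]_(T <- enum fine_types) D T.
Proof.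
rewrite -bigcup_seq; apply/seteqP; split=> z.
  move=> /permutohedron_projP[y /(transport_cover hA)[p [y' zy']]].
  exists (fine_type A p); last by apply/permutohedron_projP; exists y'.
  by rewrite /= mem_enum inE; apply/asboolP; exists p.
move=> [T /=]; rewrite mem_enum => /fine_typesP[p ->].
move=> /permutohedron_projP[y zy]; apply/permutohedron_projP; exists y.
by apply: transport_mono zy => i k; exact: fine_type_sub.
Qed.

End MixedSubdivision.

Theorem proposition4p23 (R : realType) (d n : nat) (hd : (0 < d)%N)
    (A : 'M[\bar R]_(d, n)) (hA : tropical_matrix A)
    (hgen : sufficiently_generic A) :
  hyperplane_volume (@gen_permutohedron R d n (support_graph A)) =
  (\sum_(T in vertex_types A)
     \prod_(k < n) ((right_degree T k).-1`!%:R)^-1)%:E.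
Proof.
case: d hd A hA hgen => [//|d] _ A hA hgen.
have -> : hyperplane_volume (@gen_permutohedron R d.+1 n (support_graph A)) =
    lebesgue_tuple (@permutohedron_proj R d n (support_graph A)) by [].
rewrite (mixed_cells_cover hA) measure_almost_disjoint; last 3 first.
- exact: enum_uniq.
- by move=> T; exact: measurable_permutohedron_proj.
- move=> T T'; rewrite !mem_enum => /fine_typesP[p ->] /fine_typesP[p' ->] TT'.
  apply: (mixed_cells_overlap_null hA (p := p) (p' := p')) => // -[c p'E].
  by rewrite p'E fine_type_translate ?eqxx in TT'.
rewrite big_enum (bigID (mem (vertex_types A)))/=.
rewrite [X in (_ + X)%E]big1; last first.
  by move=> T /andP[/fine_typesP[p ->]]; exact: nonvertex_cell_null.
rewrite adde0 -sumEFin; apply: eq_big => [T|T /andP[_ TV]]; last first.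
  exact: (vertex_cell_volume hA hgen TV).
apply: andb_idl; rewrite [T \in vertex_types A]inE => /asboolP[rT _].
by rewrite inE; apply/asboolP.
Qed.
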